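(* Let $(M,g)$ be a $7$-dimensional oriented Riemannian spin manifold and let $\varphi$ be a unit spinor field on $M$, defining a $G_2$-structure, and let $S\in\mathrm{End}(TM)$ be the endomorphism with $\nabla^g_X\varphi=S(X)\cdot\varphi$ for all $X\in TM$. (1) If the $G_2$-structure belongs to the pure class $\mathcal W_1$, i.e. $S=\lambda\,\mathrm{Id}$ for a smooth function $\lambda$ on $M$, then it is harmonic if and only if $\lambda$ is a constant, i.e. the $G_2$-structure is nearly parallel. (2) If the $G_2$-structure belongs to the pure class $\mathcal W_3$, i.e. $S$ is symmetric and traceless, then it is harmonic.
   Context: Spinors: $\Delta=\mathbb R^8$ is the real spin representation of $\mathrm{Spin}(7)$ (obtained from a fixed irreducible real Clifford module with $X\cdot X=-|X|^2$, with an inner product for which unit vectors act orthogonally). $S(M)$ is the associated real spinor bundle of a fixed spin structure, and $\nabla^g$ is the Levi-Civita connection and the connection it induces on $S(M)$. For a unit spinor $\varphi$ there is an orthogonal decomposition $\Delta=\mathrm{span}\{\varphi\}\oplus\{X\cdot\varphi\mid X\in\mathbb R^7\}$. Hence for a unit spinor field $\varphi$ there is a unique $S\in\mathrm{End}(TM)$ with $\nabla^g_X\varphi=S(X)\cdot\varphi$. ''Nearly parallel'' means $S=\lambda\,\mathrm{Id}$ with $\lambda$ constant. $G_2$-structure and harmonicity: the stabilizer of a unit spinor in $\mathrm{Spin}(7)$ maps isomorphically onto a subgroup $G_2\subset SO(7)$, so $\varphi$ defines a reduction $P\subset SO(M)$ to $G=G_2$. With $\mathfrak{so}(7)=\mathfrak{g}\oplus\mathfrak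 m$ ($\mathfrak g=\mathfrak g_2$, $\mathfrak m=\mathfrak g_2^\perp$), the $\mathfrak g$-component of the Levi-Civita connection form restricted to $P$ defines a connection $\nabla^G$, and the intrinsic torsion is $\xi_XY=\nabla^G_XY-\nabla^g_XY$. The structure is called harmonic if $L:=\sum_i(\nabla^g_{e_i}\xi)_{e_i}=0$ for local orthonormal frames $(e_i)$ (also when $M$ is non-compact).
   Formalization: The manifold M is assumed connected; otherwise (1) fails, e.g. on a disjoint union of two nearly parallel 7-spheres of different radii, where λ is only locally constant; (2) then follows for general M component by component. *)

(* Defs.v *)
From HB Require Import structures.
From mathcomp Require Import all_boot all_order all_algebra.
From mathcomp Require Import all_classical all_reals all_analysis.

Set Implicit Arguments.
Unset Strict Implicit.
Unset Printing Implicit Defensive.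

Import Order.TTheory GRing.Theory Num.Theory.
Import numFieldNormedType.Exports.
Local Open Scope classical_set_scope.
Local Open Scope ring_scope.

(* Tensors on the 7-manifold M are families of components, one for each chart.
   Tangent vectors are row vectors, so endomorphisms act by right
   multiplication, v |-> v *m T, and the rows of a 7 x 7 matrix F can be read as
   the members of a frame (e_1, ..., e_7). *)

Record atlas (R : realType) (M : topologicalType) := Atlas {
  chart : Type;
  dom : chart -> set M;
  local_coord : chart -> M -> 'rV[R]_7;
  local_param : chart -> 'rV[R]_7 -> M }.

Definition basis_vec (R : realType) (i : 'I_7) : 'rV[R]_7 := delta_mx 0 i.

(* Derivative of F at p along the tangent vector with components v in chart a. *)
Definition mder (R : realType) (M : topologicalType) (A : atlas R M)
    (V : normedModType R) (a : chart A) (v : 'rV[R]_7) (F : M -> V) (p : M) : V :=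
  'D_v (F \o local_param a) (local_coord a p).

(* C^infinity on W: all iterated derivatives along constant coordinate
   directions are differentiable. *)
Definition smooth_in (R : realType) (M : topologicalType) (A : atlas R M)
    (V : normedModType R) (a : chart A) (W : set M) (F : M -> V) : Prop :=
  forall (s : seq 'rV[R]_7) (p : M), W p -> dom a p ->
    differentiable (foldr (fun v G => mder a v G) F s \o local_param a)
                   (local_coord a p).

Definition smooth_on (R : realType) (M : topologicalType) (A : atlas R M)
    (V : normedModType R) (W : set M) (F : M -> V) : Prop :=
  forall a : chart A, smooth_in a W F.

Definition jac (R : realType) (M : topologicalType) (A : atlas R M)
    (a b : chart A) (p : M) : 'M[R]_7 :=
  \matrix_(i, k) mder a (basis_vec R i) (local_coord b) p 0 k.

(* The orientation is the one for which all charts of A are positive. *)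
Record oriented_manifold (R : realType) (M : topologicalType) (A : atlas R M)
    : Prop := OrientedManifold {
  om_hausdorff : hausdorff_space M;
  om_second_countable : @second_countable M;
  om_connected : connected [set: M];
  om_dom_open : forall a : chart A, open (dom a);
  om_cover : forall p : M, exists a : chart A, dom a p;
  om_image_open : forall a : chart A, open (local_coord a @` dom a);
  om_paramK : forall (a : chart A) (p : M), dom a p ->
    local_param a (local_coord a p) = p;
  om_coord_cont : forall (a : chart A) (p : M), dom a p ->
    {for p, continuous (local_coord a)};
  om_param_cont : forall (a : chart A) (p : M), dom a p ->
    {for local_coord a p, continuous (local_param a)};
  om_smooth : forall a b : chart A,
    smooth_in a (dom b) (local_coord b);
  om_oriented : forall (a b : chart A) (p : M),
    dom a p -> dom b p -> 0 < \det (jac a b p) }.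

Definition mfield (R : realType) (M : topologicalType) (A : atlas R M) : Type :=
  chart A -> M -> 'M[R]_7.

Record riemannian_metric (R : realType) (M : topologicalType) (A : atlas R M)
    (g : mfield A) : Prop := RiemannianMetric {
  rm_smooth : forall a : chart A, smooth_in a [set: M] (g a);
  rm_tensor : forall (a b : chart A) (p : M),
    dom a p -> dom b p ->
    g a p = jac a b p *m g b p *m (jac a b p)^T;
  rm_sym : forall (a : chart A) (p : M), dom a p -> (g a p)^T = g a p;
  rm_pos : forall (a : chart A) (p : M), dom a p ->
    forall v : 'rV[R]_7, v != 0 -> 0 < (v *m g a p *m v^T) 0 0 }.

Record endomorphism_field (R : realType) (M : topologicalType) (A : atlas R M)
    (S : mfield A) : Prop := EndomorphismField {
  ef_smooth : forall a : chart A, smooth_in a [set: M] (S a);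
  ef_tensor : forall (a b : chart A) (p : M),
    dom a p -> dom b p -> S a p *m jac a b p = jac a b p *m S b p }.

(* Smooth positively oriented orthonormal frame on W, i.e. a section of SO(M). *)
Record so_frame (R : realType) (M : topologicalType) (A : atlas R M)
    (g : mfield A) (W : set M) (F : mfield A) : Prop := SoFrame {
  sf_smooth : forall a : chart A, smooth_in a W (F a);
  sf_tensor : forall (a b : chart A) (p : M),
    W p -> dom a p -> dom b p -> F b p = F a p *m jac a b p;
  sf_orthonormal : forall (a : chart A) (p : M), W p -> dom a p ->
    F a p *m g a p *m (F a p)^T = 1%:M;
  sf_positive : forall (a : chart A) (p : M), W p -> dom a p ->
    0 < \det (F a p) }.

(* Entry (j, k) of T a p i is the coefficient of d_k in the value at (d_i, d_j).
   For a connection these are the Christoffel symbols Gamma_ij^k, for a (1,2)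
   tensor T they are the components of T_{d_i} d_j. *)
Definition coeffs (R : realType) (M : topologicalType) (A : atlas R M) : Type :=
  chart A -> M -> 'I_7 -> 'M[R]_7.

Definition along (R : realType) (M : topologicalType) (A : atlas R M)
    (T : coeffs A) (a : chart A) (p : M) (v : 'rV[R]_7) : 'M[R]_7 :=
  \sum_i v 0 i *: T a p i.

Definition levi_civita (R : realType) (M : topologicalType) (A : atlas R M)
    (g : mfield A) : coeffs A :=
  fun a p i => \matrix_(j, k) (2^-1 * \sum_l
    (mder a (basis_vec R i) (g a) p j l + mder a (basis_vec R j) (g a) p i l
     - mder a (basis_vec R l) (g a) p i j) * invmx (g a p) l k).

(* Connection form: entry (i, j) is g(nabla_v e_i, e_j), for the orthonormal
   frame (e_i) given by the rows of F. *)
Definition conn_form (R : realType) (M : topologicalType) (A : atlas R M)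
    (g : mfield A) (Gam : coeffs A) (F : mfield A) (a : chart A) (p : M)
    (v : 'rV[R]_7) : 'M[R]_7 :=
  (mder a v (F a) p + F a p *m along Gam a p v) *m g a p *m (F a p)^T.

(* A module structure over the Clifford algebra of R^7 with X.X = -|X|^2 on
   Delta = R^8, for which unit vectors act orthogonally; c i is the action of the
   i-th basis vector. As 8 is the least dimension of a nonzero real module over
   this algebra, such a module is irreducible. *)
Record clifford_module (R : realType) (c : 'I_7 -> 'M[R]_8) : Prop :=
    CliffordModule {
  cm_rel : forall i j : 'I_7, c i *m c j + c j *m c i = (- ((i == j)%:R *+ 2))%:M;
  cm_orth : forall i : 'I_7, (c i)^T *m c i = 1%:M }.

Definition cl (R : realType) (c : 'I_7 -> 'M[R]_8) (x : 'rV[R]_7) : 'M[R]_8 :=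
  \sum_i x 0 i *: c i.

(* Spin(7), acting faithfully on Delta: products of an even number of unit
   vectors. *)
Inductive spin_group (R : realType) (c : 'I_7 -> 'M[R]_8) : 'M[R]_8 -> Prop :=
| spin_one : spin_group c 1%:M
| spin_mul (x y : 'rV[R]_7) (u : 'M[R]_8) :
    x *m x^T = 1%:M -> y *m y^T = 1%:M -> spin_group c u ->
    spin_group c (cl c x *m cl c y *m u).

(* The double covering Spin(7) -> SO(7), u X u^-1 = X Q (Q acts on rows). *)
Definition covers (R : realType) (c : 'I_7 -> 'M[R]_8) (u : 'M[R]_8)
    (Q : 'M[R]_7) : Prop :=
  forall x : 'rV[R]_7, u *m cl c x = cl c (x *m Q) *m u.

(* Inverse differential so(7) -> spin(7) of the covering; it satisfies
   [spin_lift c B, cl c x] = cl c (x *m B). *)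
Definition spin_lift (R : realType) (c : 'I_7 -> 'M[R]_8) (B : 'M[R]_7)
    : 'M[R]_8 :=
  4^-1 *: \sum_i \sum_j B i j *: (c i *m c j).

Definition unit_spinor (R : realType) (s : 'cV[R]_8) : Prop := s^T *m s = 1%:M.

(* A spin structure as a lift to Spin(7) of a cocycle of SO(M): sframe b is a
   local section of SO(M) over sdom b, covered by a section of the
   Spin(7)-bundle, and strans b b' is the Spin(7)-valued transition function
   from the b- to the b'-section. *)
Record spin_data (R : realType) (M : topologicalType) (A : atlas R M) :=
    SpinData {
  sidx : Type;
  sdom : sidx -> set M;
  sframe : sidx -> mfield A;
  strans : sidx -> sidx -> M -> 'M[R]_8 }.

Record spin_structure (R : realType) (M : topologicalType) (A : atlas R M)
    (g : mfield A) (c : 'I_7 -> 'M[R]_8) (P : spin_data A) : Prop :=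
    SpinStructure {
  ss_open : forall b : sidx P, open (sdom b);
  ss_cover : forall p : M, exists b : sidx P, sdom b p;
  ss_frame : forall b : sidx P, so_frame g (sdom b) (sframe b);
  ss_smooth : forall b b' : sidx P,
    smooth_on A (sdom b `&` sdom b') (strans b b');
  ss_spin : forall (b b' : sidx P) (p : M),
    sdom b p -> sdom b' p ->
    spin_group c (strans b b' p);
  ss_lift : forall (b b' : sidx P) (a : chart A) (p : M) (Q : 'M[R]_7),
    sdom b p -> sdom b' p -> dom a p ->
    sframe b' a p = Q *m sframe b a p ->
    covers c (strans b b' p) Q;
  ss_cocycle : forall (b b' b'' : sidx P) (p : M),
    sdom b p -> sdom b' p -> sdom b'' p ->
    strans b b' p *m strans b' b'' p = strans b b'' p }.

(* Smooth section of S(M) = Spin(M) x_Spin(7) Delta of length one. *)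
Record unit_spinor_field (R : realType) (M : topologicalType) (A : atlas R M)
    (P : spin_data A) (phi : sidx P -> M -> 'cV[R]_8) : Prop := UnitSpinorField {
  sp_smooth : forall b : sidx P, smooth_on A (sdom b) (phi b);
  sp_trans : forall (b b' : sidx P) (p : M),
    sdom b p -> sdom b' p ->
    phi b p = strans b b' p *m phi b' p;
  sp_unit : forall (b : sidx P) (p : M), sdom b p ->
    unit_spinor (phi b p) }.

(* nabla^g_v phi in the trivialization b; v is given in the chart a. *)
Definition nabla_spinor (R : realType) (M : topologicalType) (A : atlas R M)
    (g : mfield A) (c : 'I_7 -> 'M[R]_8) (P : spin_data A)
    (phi : sidx P -> M -> 'cV[R]_8) (b : sidx P) (a : chart A) (p : M)
    (v : 'rV[R]_7) : 'cV[R]_8 :=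
  mder a v (phi b) p
  + spin_lift c (conn_form g (levi_civita g) (sframe b) a p v) *m phi b p.

(* v . phi: the vector v, given in the chart a, has coordinates v g F^T in the
   orthonormal frame F. *)
Definition clifford_mul (R : realType) (M : topologicalType) (A : atlas R M)
    (g : mfield A) (c : 'I_7 -> 'M[R]_8) (P : spin_data A)
    (phi : sidx P -> M -> 'cV[R]_8) (b : sidx P) (a : chart A) (p : M)
    (v : 'rV[R]_7) : 'cV[R]_8 :=
  cl c (v *m g a p *m (sframe b a p)^T) *m phi b p.

Definition spinor_endomorphism (R : realType) (M : topologicalType)
    (A : atlas R M) (g : mfield A) (c : 'I_7 -> 'M[R]_8) (P : spin_data A)
    (phi : sidx P -> M -> 'cV[R]_8) (S : mfield A) : Prop :=
  forall (b : sidx P) (a : chart A) (p : M) (v : 'rV[R]_7),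
    sdom b p -> dom a p ->
    nabla_spinor g c phi b a p v = clifford_mul g c phi b a p (v *m S a p).

(* Local section over W of the G_2-reduction of SO(M) defined by phi: with
   G_2 the stabilizer of phi0, at each point the frame F has a lift f in Spin(M)
   such that phi = [f, phi0]. *)
Definition adapted_frame (R : realType) (M : topologicalType) (A : atlas R M)
    (g : mfield A) (c : 'I_7 -> 'M[R]_8) (P : spin_data A)
    (phi : sidx P -> M -> 'cV[R]_8) (phi0 : 'cV[R]_8) (W : set M) (F : mfield A)
    : Prop :=
  so_frame g W F /\
  forall (b : sidx P) (a : chart A) (p : M),
    W p -> sdom b p -> dom a p ->
    exists (u : 'M[R]_8) (Q : 'M[R]_7),
      [/\ spin_group c u, covers c u Q, F a p = Q *m sframe b a p
        & phi b p = u *m phi0].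

Definition so7 (R : realType) (B : 'M[R]_7) : Prop := B^T = - B.

(* Lie algebra of the stabilizer of phi0 in Spin(7), as a subalgebra of so(7). *)
Definition g2 (R : realType) (c : 'I_7 -> 'M[R]_8) (phi0 : 'cV[R]_8)
    (B : 'M[R]_7) : Prop :=
  so7 B /\ spin_lift c B *m phi0 = 0.

Definition g2_perp (R : realType) (c : 'I_7 -> 'M[R]_8) (phi0 : 'cV[R]_8)
    (B : 'M[R]_7) : Prop :=
  so7 B /\ forall C : 'M[R]_7, g2 c phi0 C -> \tr (B^T *m C) = 0.

(* nablaG is the connection whose form, in every local section of the
   G_2-reduction, is the g2-component of the Levi-Civita connection form. *)
Definition g2_connection (R : realType) (M : topologicalType) (A : atlas R M)
    (g : mfield A) (c : 'I_7 -> 'M[R]_8) (P : spin_data A)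
    (phi : sidx P -> M -> 'cV[R]_8) (phi0 : 'cV[R]_8) (nablaG : coeffs A)
    : Prop :=
  forall (W : set M) (F : mfield A),
    open W -> adapted_frame g c phi phi0 W F ->
    forall (a : chart A) (p : M) (v : 'rV[R]_7), W p -> dom a p ->
      g2 c phi0 (conn_form g nablaG F a p v) /\
      g2_perp c phi0 (conn_form g (levi_civita g) F a p v
                      - conn_form g nablaG F a p v).

Definition intrinsic_torsion (R : realType) (M : topologicalType)
    (A : atlas R M) (g : mfield A) (nablaG : coeffs A) : coeffs A :=
  fun a p i => nablaG a p i - levi_civita g a p i.

(* (nabla^g_v T)_w as an endomorphism, for a (1,2) tensor T and tangent vectors
   v, w: nabla^g_v(T_w Y) - T_{nabla^g_v w} Y - T_w (nabla^g_v Y), with w and Y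
   extended with constant components in the chart a. *)
Definition cov_der (R : realType) (M : topologicalType) (A : atlas R M)
    (g : mfield A) (T : coeffs A) (a : chart A) (p : M) (v w : 'rV[R]_7)
    : 'M[R]_7 :=
  let G := along (levi_civita g) a p v in
  mder a v (fun q => along T a q w) p + along T a p w *m G
  - along T a p (w *m G) - G *m along T a p w.

(* L = 0; the sum depends only on the values of the frame (e_i) at p, which are
   the rows of E. *)
Definition harmonic_g2 (R : realType) (M : topologicalType) (A : atlas R M)
    (g : mfield A) (nablaG : coeffs A) : Prop :=
  forall (a : chart A) (p : M) (E : 'M[R]_7), dom a p ->
    E *m g a p *m E^T = 1%:M ->
    \sum_i cov_der g (intrinsic_torsion g nablaG) a p (row i E) (row i E) = 0.

Definition scalar_endo (R : realType) (M : topologicalType) (A : atlas R M)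
    (S : mfield A) (lam : M -> R) : Prop :=
  forall (a : chart A) (p : M), dom a p -> S a p = (lam p)%:M.

Definition is_constant (R : realType) (M : topologicalType) (lam : M -> R) : Prop :=
  exists k : R, forall p : M, lam p = k.

Definition nearly_parallel (R : realType) (M : topologicalType) (A : atlas R M)
    (S : mfield A) : Prop :=
  exists k : R, scalar_endo S (fun=> k).

Definition symmetric_endo (R : realType) (M : topologicalType) (A : atlas R M)
    (g S : mfield A) : Prop :=
  forall (a : chart A) (p : M) (v w : 'rV[R]_7), dom a p ->
    v *m S a p *m g a p *m w^T = v *m g a p *m (w *m S a p)^T.

Definition traceless_endo (R : realType) (M : topologicalType) (A : atlas R M)
    (S : mfield A) : Prop :=
  forall (a : chart A) (p : M), dom a p -> \tr (S a p) = 0.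

(* Main.v *)
Require Import Defs.
From HB Require Import structures.
From mathcomp Require Import all_boot all_order all_algebra.
From mathcomp Require Import all_classical all_reals all_analysis.
From mathcomp Require Import ring lra.

(** The intrinsic torsion of the G_2-structure of a unit spinor phi is a
    constant multiple of the 3-form of phi contracted with S: in an orthonormal
    frame, xi_X is 2/3 of the skew matrix with entries <phi, S(X) e_j e_k phi>
    ([torsion_formula]). In a frame adapted to phi the spinor is constant, so
    nabla^g phi is the Clifford action of the m-part of the connection form,
    that is of - xi, on phi; as m is a copy of R^7 on which this action is
    injective, S determines xi ([g2_perp_cross]).

    Differentiating this formula gives (nabla_X xi)_X as the contraction of the
    3-form with (nabla_X S)(X), plus a term from the derivative of the 3-form,
    which is quadratic in S(X). That term vanishes, because the derivative of the
    3-form in the direction of Y . phi is zero when contracted with Y itself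
    ([cross_var_diag]). Summing over a frame, L is 2/3 of the contraction of the
    3-form with the divergence of S ([torsion_divergence]), and contraction with
    the 3-form is injective: the structure is harmonic exactly when div S = 0
    ([harmonic_at]).

    For S = lambda Id the divergence is the gradient of lambda, which vanishes
    exactly when lambda is constant, M being connected ([harmonic_scalar]).

    For S symmetric and traceless, the curvature of phi is
    R(X, Y) phi = ((nabla_X S) Y - (nabla_Y S) X) . phi
      + (S(Y) S(X) - S(X) S(Y)) . phi  ([spinor_curvature]).
    Contract this with the Clifford products e_i e_j. On the left the first
    Bianchi identity leaves a multiple of phi, as in the Lichnerowicz formula
    ([lichnerowicz_scalar]). On the right, since S and its covariant derivatives
    are symmetric and traceless, what remains is 2 (div S) . phi and a multiple of
    phi ([dirac_contraction]). But (div S) . phi is orthogonal to phi, so it is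
    zero, and div S = 0 ([traceless_divergence]).

    The definition of the G_2-connection speaks of adapted frames only, so the
    formula for xi needs one near every point. It comes from an explicit smooth
    product of two unit vectors in Spin(7) that carries a fixed unit spinor to
    phi ([adapted_frame_exists]).

    Vectors are rows, on which endomorphisms and frames act from the right. All
    local computations take place on open subsets of R^7, with frames, connection
    forms and spinors as matrix-valued functions. *)

Set Implicit Arguments.
Unset Strict Implicit.
Unset Printing Implicit Defensive.

Import Order.TTheory GRing.Theory Num.Theory.
Import numFieldNormedType.Exports.
Local Open Scope classical_set_scope.
Local Open Scope ring_scope.

(** * Matrix identities and the inner product of spinors *)

(** Products, sums and derivatives become atoms, after which an identity between
    matrices that uses only their addition holds entrywise by [ring]. *)
Ltac mxgen := repeat match goal with
  | |- context [@mulmx ?r ?m ?n ?p ?A ?B] =>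
      let x := fresh "x" in set x := (@mulmx r m n p A B); clearbody x
  | |- context [@bigop ?a ?b ?c ?d ?e] =>
      let x := fresh "x" in set x := (@bigop a b c d e); clearbody x
  | |- context [@derive ?K ?V ?W ?f ?a ?v] =>
      let x := fresh "x" in set x := (@derive K V W f a v); clearbody x
  end.
Ltac mxabel := mxgen; apply/matrixP => ? ?; rewrite ?mxE; ring.
Ltac mxexpand := rewrite ?(mulmxDl, mulmxDr, mulmxN, mulNmx) ?mulmxA ?opprK.

Section InnerProduct.
Variable R : realType.

Lemma mulS_inj (V : lmodType R) (n : nat) (u v : V) :
  u *+ n.+1 = v *+ n.+1 -> u = v.
Proof.
rewrite -(scaler_nat n.+1 u) -(scaler_nat n.+1 v) => h.
have : (n.+1%:R^-1 : R) *: (n.+1%:R *: u) = n.+1%:R^-1 *: (n.+1%:R *: v) by rewrite h.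
by rewrite !scalerA mulVf ?pnatr_eq0 // !scale1r.
Qed.

Lemma trmxZ m n a (B : 'M[R]_(m, n)) : (a *: B)^T = a *: B^T.
Proof. by apply/matrixP => i j; rewrite !mxE. Qed.

Definition dot (n : nat) (s t : 'cV[R]_n) : R := (s^T *m t) 0 0.

Lemma dotE n (s t : 'cV[R]_n) : s^T *m t = (dot s t)%:M.
Proof. by rewrite [LHS]mx11_scalar. Qed.

Lemma dotC n (s t : 'cV[R]_n) : dot s t = dot t s.
Proof. by rewrite /dot -[in RHS](trmxK s) -trmx_mul [RHS]mxE. Qed.

Lemma dotDr n (s t u : 'cV[R]_n) : dot s (t + u) = dot s t + dot s u.
Proof. by rewrite /dot mulmxDr mxE. Qed.

Lemma dotDl n (s t u : 'cV[R]_n) : dot (s + t) u = dot s u + dot t u.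
Proof. by rewrite dotC dotDr !(dotC u). Qed.

Lemma dotZr n (s t : 'cV[R]_n) a : dot s (a *: t) = a * dot s t.
Proof. by rewrite /dot -scalemxAr mxE. Qed.

Lemma dotZl n (s t : 'cV[R]_n) a : dot (a *: s) t = a * dot s t.
Proof. by rewrite dotC dotZr dotC. Qed.

Lemma dotNr n (s t : 'cV[R]_n) : dot s (- t) = - dot s t.
Proof. by rewrite -scaleN1r dotZr mulN1r. Qed.

Lemma dotNl n (s t : 'cV[R]_n) : dot (- s) t = - dot s t.
Proof. by rewrite dotC dotNr dotC. Qed.

Lemma dotBr n (s t u : 'cV[R]_n) : dot s (t - u) = dot s t - dot s u.
Proof. by rewrite dotDr dotNr. Qed.

Lemma dotMr n m (A : 'M[R]_(n, m)) s t : dot s (A *m t) = dot (A^T *m s) t.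
Proof. by rewrite /dot trmx_mul trmxK mulmxA. Qed.

Lemma dot_sumr n (I : finType) (s : 'cV[R]_n) (F : I -> 'cV[R]_n) :
  dot s (\sum_i F i) = \sum_i dot s (F i).
Proof. by rewrite /dot mulmx_sumr summxE. Qed.

Lemma dot_skew n (A : 'M[R]_n) s : A^T = - A -> dot s (A *m s) = 0.
Proof.
move=> hA; have : dot s (A *m s) = - dot s (A *m s).
  by rewrite {1}dotMr hA mulNmx dotNl dotC.
by lra.
Qed.

Lemma dot_ss n (s : 'cV[R]_n) : dot s s = \sum_i s i 0 ^+ 2.
Proof. by rewrite /dot mxE; apply: eq_bigr => i _; rewrite mxE expr2. Qed.

Lemma dot_ge0 n (s : 'cV[R]_n) : 0 <= dot s s.
Proof. by rewrite dot_ss sumr_ge0 // => i _; apply: sqr_ge0. Qed.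

Lemma dot_eq0 n (s : 'cV[R]_n) : dot s s = 0 -> s = 0.
Proof.
rewrite dot_ss => /eqP; rewrite psumr_eq0; last by move=> i _; apply: sqr_ge0.
move=> /allP h; apply/matrixP => i j; rewrite ord1 mxE.
by have := h i (mem_index_enum _); rewrite sqrf_eq0 => /eqP.
Qed.

Lemma unit_dot (s : 'cV[R]_8) : unit_spinor s -> dot s s = 1.
Proof. by rewrite /unit_spinor /dot => ->; rewrite mxE eqxx. Qed.

Lemma mxtrace_dot m n (A B : 'M[R]_(m, n)) :
  \tr (A^T *m B) = \sum_i \sum_j A i j * B i j.
Proof.
rewrite exchange_big; apply: eq_bigr => j _; rewrite mxE.
by apply: eq_bigr => i _; rewrite mxE.
Qed.

Lemma mxtrace_sq_eq0 n (B : 'M[R]_n) : \tr (B^T *m B) = 0 -> B = 0.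
Proof.
rewrite /mxtrace.
have E i : (B^T *m B) i i = \sum_j B j i ^+ 2.
  by rewrite mxE; apply: eq_bigr => j _; rewrite mxE expr2.
rewrite (eq_bigr _ (fun i _ => E i)) => /eqP.
rewrite psumr_eq0; last by move=> i _; apply: sumr_ge0 => j _; apply: sqr_ge0.
move=> /allP h; apply/matrixP => i j; rewrite mxE.
have := h j (mem_index_enum _); rewrite psumr_eq0; last by move=> ? _; apply: sqr_ge0.
by move=> /allP /(_ i (mem_index_enum _)); rewrite sqrf_eq0 => /eqP.
Qed.

Lemma row_dot n (x y : 'rV[R]_n) : (x *m y^T) 0 0 = \sum_i x 0 i * y 0 i.
Proof. by rewrite mxE; apply: eq_bigr => i _; rewrite mxE. Qed.

End InnerProduct.

(** * The Clifford algebra of R^7 on spinors *)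

Section Clifford.
Variables (R : realType) (c : 'I_7 -> 'M[R]_8).
Hypothesis hc : clifford_module c.
Implicit Types (x y z : 'rV[R]_7) (s t : 'cV[R]_8) (A B : 'M[R]_7).

Lemma cl_delta i : cl c (delta_mx 0 i) = c i.
Proof.
rewrite /cl (bigD1 i) //= big1 => [|j ji]; rewrite !mxE ?eqxx ?scale1r ?addr0 //.
by rewrite (negbTE ji) andbF scale0r.
Qed.

Lemma cl_is_linear : linear (cl c).
Proof.
move=> a x y; rewrite /cl scaler_sumr -big_split; apply: eq_bigr => i _ /=.
by rewrite !mxE scalerDl -scalerA.
Qed.

HB.instance Definition _ := GRing.isLinear.Build R _ _ _ (cl c) cl_is_linear.

Lemma cliffC i j : c j *m c i = - (c i *m c j) - ((i == j)%:R *+ 2)%:M.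
Proof. by have := cm_rel hc i j; rewrite raddfN => <-; rewrite addKr. Qed.

Lemma cliff_sq i : c i *m c i = - 1%:M.
Proof.
have := cm_rel hc i i; rewrite eqxx -mulr2n raddfN raddfMn /= -mulNrn.
exact: mulS_inj.
Qed.

Lemma cliff_tr i : (c i)^T = - c i.
Proof.
have := congr1 (mulmx (c i)^T) (cliff_sq i).
by rewrite mulmxA (cm_orth hc) mul1mx mulmxN mulmx1 => h; rewrite [in RHS]h opprK.
Qed.

Lemma cl_tr x : (cl c x)^T = - cl c x.
Proof.
rewrite /cl raddf_sum -sumrN; apply: eq_bigr => i _.
by rewrite [LHS]trmxZ cliff_tr scalerN.
Qed.

Lemma clC x y : cl c y *m cl c x = - (cl c x *m cl c y) - (((x *m y^T) 0 0) *+ 2)%:M.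
Proof.
have -> : cl c y *m cl c x = \sum_i \sum_j (x 0 i * y 0 j) *: (c j *m c i).
  rewrite /cl mulmx_sumr; apply: eq_bigr => i _.
  rewrite mulmx_suml; apply: eq_bigr => j _.
  by rewrite -scalemxAl -scalemxAr scalerA mulrC.
have -> : cl c x *m cl c y = \sum_i \sum_j (x 0 i * y 0 j) *: (c i *m c j).
  rewrite /cl mulmx_suml; apply: eq_bigr => i _.
  rewrite mulmx_sumr; apply: eq_bigr => j _.
  by rewrite -scalemxAl -scalemxAr scalerA.
have -> : (((x *m y^T) 0 0) *+ 2)%:M
    = \sum_i \sum_j (x 0 i * y 0 j) *: ((i == j)%:R *+ 2)%:M :> 'M[R]_8.
  rewrite row_dot -sumrMnl raddf_sum; apply: eq_bigr => i _ /=.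
  rewrite (bigD1 i) //= big1 => [|j ji].
    by rewrite eqxx addr0 scale_scalar_mx mulrnAr mulr1.
  by rewrite eq_sym (negbTE ji) mul0rn scale_scalar_mx mulr0 raddf0.
rewrite -!sumrN -big_split; apply: eq_bigr => i _ /=.
rewrite -!sumrN -big_split; apply: eq_bigr => j _ /=.
by rewrite cliffC scalerBr scalerN.
Qed.

Lemma cl_sq x : cl c x *m cl c x = (- (x *m x^T) 0 0)%:M.
Proof.
apply: (mulS_inj (n := 1)); rewrite mulr2n {1}clC addrAC addNr add0r.
by rewrite raddfN raddfMn /= mulNrn.
Qed.

Lemma dot_cl x s : dot s (cl c x *m s) = 0.
Proof. exact/dot_skew/cl_tr. Qed.

Lemma dot_clcl x y s :
  dot (cl c x *m s) (cl c y *m s) = (x *m y^T) 0 0 * dot s s.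
Proof.
have h : dot (cl c y *m s) (cl c x *m s) = 2 * ((x *m y^T) 0 0 * dot s s)
    - dot (cl c x *m s) (cl c y *m s).
  rewrite dotMr mulmxA cl_tr mulNmx clC opprB opprK mulmxDl mul_scalar_mx.
  rewrite dotDl dotZl -mulmxA [X in _ + X]dotC dotMr cl_tr mulNmx dotNl.
  by rewrite -[y *m x^T]trmxK trmx_mul trmxK [_^T _ _]mxE mulr_natl mulrnAl (dotC (cl c x *m s)).
by move: h; rewrite dotC; lra.
Qed.

(** The eight spinors s, c_i s are orthogonal of the same length. The matrix N of
    these columns satisfies N^T N = |s|^2, hence also N N^T = |s|^2, which is the
    claim. *)
Lemma clifford_basis s :
  s *m s^T + \sum_i (c i *m s) *m (c i *m s)^T = (dot s s)%:M.
Proof.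
pose b (i : 'I_8) : 'cV[R]_8 := if unlift ord0 i is Some j then c j *m s else s.
pose N : 'M[R]_8 := \matrix_(k, i) b i k 0.
have b0 : b ord0 = s by rewrite /b unlift_none.
have bS j : b (lift ord0 j) = c j *m s by rewrite /b liftK.
have bb i j : dot (b i) (b j) = (i == j)%:R * dot s s.
  case: (unliftP ord0 i) => [i'|] ->; case: (unliftP ord0 j) => [j'|] ->.
  - rewrite !bS -!cl_delta dot_clcl (inj_eq lift_inj) row_dot (bigD1 i') //=.
    rewrite big1 => [|l li]; last by rewrite !mxE (negbTE li) andbF mul0r.
    by rewrite !mxE !eqxx /= mul1r addr0.
  - by rewrite bS b0 -cl_delta dotC dot_cl eq_sym (negbTE (neq_lift _ _)) mul0r.
  - by rewrite bS b0 -cl_delta dot_cl (negbTE (neq_lift _ _)) mul0r.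
  - by rewrite b0 eqxx mul1r.
have NN : N^T *m N = (dot s s)%:M.
  apply/matrixP => i j; rewrite [RHS]mxE -mulr_natl -bb mxE [RHS]mxE.
  by apply: eq_bigr => k _; rewrite !mxE.
have -> : s *m s^T + \sum_i (c i *m s) *m (c i *m s)^T = N *m N^T.
  apply/matrixP => k l; rewrite [RHS]mxE [RHS]big_ord_recl [LHS]mxE.
  congr (_ + _); first by rewrite !mxE big_ord1 !mxE b0.
  rewrite summxE; apply: eq_bigr => i _.
  have NE m : N m (lift ord0 i) = (c i *m s) m 0 by rewrite /N [LHS]mxE bS.
  by rewrite [LHS]mxE big_ord1 [N^T _ _]mxE !NE [_^T _ _]mxE.
(* If s = 0, the matrix N cannot be inverted, but it vanishes. *)
have [s0|s0] := eqVneq (dot s s) 0; last first.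
  have := mulmx1C (A := (dot s s)^-1 *: N^T) (B := N).
  rewrite -scalemxAl NN scale_scalar_mx mulVf // => /(_ erefl).
  rewrite -scalemxAr => /(congr1 (fun K => dot s s *: K)).
  by rewrite scalerA mulfV // scale1r scale_scalar_mx mulr1.
have -> : N = 0.
  apply/matrixP => k i; rewrite !mxE.
  have : dot (b i) (b i) = 0 by rewrite bb s0 mulr0.
  by move=> /dot_eq0 ->; rewrite mxE.
by rewrite s0 mul0mx raddf0.
Qed.

Lemma clifford_basis1 s : unit_spinor s ->
  \sum_i (c i *m s) *m (c i *m s)^T = 1%:M - s *m s^T.
Proof. by move=> /unit_dot h; rewrite -h -clifford_basis addrC addKr. Qed.

Lemma spinor_expand s t : unit_spinor s ->
  t = dot s t *: s + \sum_i dot (c i *m s) t *: (c i *m s).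
Proof.
move=> hs; have := clifford_basis s; rewrite unit_dot // => h.
rewrite -[LHS]mul1mx -h mulmxDl -mulmxA dotE mul_mx_scalar; congr (_ + _).
rewrite mulmx_suml; apply: eq_bigr => i _.
by rewrite -mulmxA dotE mul_mx_scalar.
Qed.

Lemma cl_inj s x : unit_spinor s -> cl c x *m s = 0 -> x = 0.
Proof.
move=> hs h; have := dot_clcl x x s; rewrite h (unit_dot hs) mulr1.
rewrite /dot mulmx0 mxE => /esym; rewrite -[x in x *m _]trmxK => /dot_eq0.
by move=> /(congr1 trmx); rewrite trmxK trmx0.
Qed.

(** Polarization of [clifford_basis]. *)
Lemma clifford_sum_outer (s t : 'cV[R]_8) :
  let N := s *m t^T + t *m s^T in
  N + \sum_i c i *m N *m (c i)^T = (dot s t *+ 2)%:M.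
Proof.
move=> N.
pose Q (u : 'cV[R]_8) := u *m u^T + \sum_i (c i *m u) *m (c i *m u)^T.
have -> : N + \sum_i c i *m N *m (c i)^T = Q (s + t) - Q s - Q t.
  have hN : N = (s + t) *m (s + t)^T - s *m s^T - t *m t^T.
    by rewrite raddfD /= mulmxDl !mulmxDr /N; mxabel.
  have -> : \sum_i c i *m N *m (c i)^T
      = \sum_i (c i *m (s + t)) *m (c i *m (s + t))^T
      - \sum_i (c i *m s) *m (c i *m s)^T - \sum_i (c i *m t) *m (c i *m t)^T.
    rewrite -!sumrB; apply: eq_bigr => i _.
    by rewrite hN !mulmxBr !mulmxBl !trmx_mul !mulmxA.
  by rewrite /Q hN; mxabel.
rewrite /Q !clifford_basis -!raddfB /=; congr _%:M.
by rewrite dotDl !dotDr (dotC t s); ring.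
Qed.

(** A symmetric matrix is half the sum of the symmetrized products of its columns
    with the standard basis, to which [clifford_sum_outer] applies. *)
Lemma clifford_sum_sym (N : 'M[R]_8) : N^T = N ->
  N + \sum_i c i *m N *m (c i)^T = (\tr N)%:M.
Proof.
move=> hN.
have E : N *+ 2 = \sum_k (col k N *m (delta_mx k 0)^T + delta_mx k 0 *m (col k N)^T).
  rewrite big_split /= mulr2n; congr (_ + _).
    rewrite {1}(matrix_sum_delta N) exchange_big; apply: eq_bigr => k _ /=.
    apply/matrixP => i j; rewrite summxE !mxE big_ord1 !mxE (bigD1 i) //= big1 => [|l li].
      by rewrite !mxE eqxx /= addr0 eqxx andbT.
    by rewrite !mxE (eq_sym i) (negbTE li) mulr0.
  rewrite -{1}hN (matrix_sum_delta N^T); apply: eq_bigr => k _ /=.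
  apply/matrixP => i j; rewrite summxE !mxE big_ord1 !mxE (bigD1 j) //= big1 => [|l li].
    by rewrite !mxE eqxx /= addr0 andbT mulrC.
  by rewrite !mxE (eq_sym j) (negbTE li) andbF mulr0.
apply: (mulS_inj (n := 1)); rewrite mulrnDl -sumrMnl.
have -> : \sum_i (c i *m N *m (c i)^T) *+ 2 = \sum_i c i *m (N *+ 2) *m (c i)^T.
  by apply: eq_bigr => i _; rewrite !mulr2n mulmxDr mulmxDl.
transitivity (\sum_k (dot (col k N) (delta_mx k 0) *+ 2)%:M : 'M[R]_8).
  rewrite -(eq_bigr _ (fun k _ => clifford_sum_outer (col k N) (delta_mx k 0))).
  rewrite big_split /= -E; congr (_ + _); rewrite exchange_big; apply: eq_bigr => i _ /=.
  by rewrite E mulmx_sumr mulmx_suml.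
rewrite -raddf_sum -raddfMn /= -sumrMnl; congr _%:M; apply: eq_bigr => k _; congr (_ *+ 2).
by rewrite /dot -colE !mxE.
Qed.

(** An elementary substitute for Schur's lemma. The matrix N = c_0 K is symmetric,
    and conjugation by c_j fixes it for j = 0 and negates it for the six other j,
    so that [clifford_sum_sym] reads - 4 N = tr N. A scalar N commutes with c_1,
    while c_0 K anticommutes with it, hence N = 0. *)
Lemma clifford_commutant_skew (K : 'M[R]_8) : K^T = - K ->
  (forall i, K *m c i = c i *m K) -> K = 0.
Proof.
move=> hK hc'.
pose i0 : 'I_7 := ord0; pose i1 : 'I_7 := lift ord0 ord0.
pose N := c i0 *m K.
have hN : N^T = N by rewrite trmx_mul hK cliff_tr mulNmx mulmxN opprK hc'.
have hNj j : c j *m N *m (c j)^T = if j == i0 then N else - N.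
  have cc k : c k *m (c k)^T = 1%:M by rewrite cliff_tr mulmxN cliff_sq opprK.
  have KC : K *m (c j)^T = (c j)^T *m K by rewrite cliff_tr mulmxN mulNmx hc'.
  rewrite /N mulmxA -mulmxA KC mulmxA.
  have [->|ji] := eqVneq j i0; first by rewrite -[c i0 *m _ *m _]mulmxA cc mulmx1.
  rewrite cliffC (eq_sym i0) (negbTE ji) mul0rn raddf0 subr0.
  by rewrite mulNmx -(mulmxA (c i0)) cc mulmx1 mulNmx.
have := clifford_sum_sym hN.
rewrite (eq_bigr _ (fun j _ => hNj j)) (bigD1 i0) //=.
rewrite (eq_bigr (fun _ => - N)); last by move=> j /negbTE ->.
rewrite sumr_const cardC1 card_ord /= => hs.
have NE : N = (- 4^-1 * \tr N)%:M.
  rewrite -scale_scalar_mx -hs !scalerDr; apply/matrixP => i j; rewrite !mxE.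
  by field.
have h1 : c i1 *m N = N *m c i1 by rewrite NE scalar_mxC.
have : N *m c i1 = - (N *m c i1).
  rewrite -{1}h1 /N mulmxA [c i1 *m c i0]cliffC mul0rn raddf0 subr0.
  by rewrite mulNmx -!mulmxA hc'.
move=> /eqP; rewrite -addr_eq0 -mulr2n => /eqP h2.
have N0 : N = 0.
  have : N *m c i1 = 0 by apply: (mulS_inj (n := 1)); rewrite h2 mul0rn.
  by move=> /(congr1 (mulmx^~ (c i1))); rewrite -mulmxA cliff_sq mulmxN mulmx1 mul0mx => /eqP; rewrite oppr_eq0 => /eqP.
have := congr1 (mulmx (c i0)) N0.
by rewrite mulmxA cliff_sq mulNmx mul1mx mulmx0 => /eqP; rewrite oppr_eq0 => /eqP.
Qed.

(** * Lifting so(7) to spin(7) *)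

Lemma lift_is_linear : linear (spin_lift c).
Proof.
move=> a A B; rewrite /spin_lift scalerA mulrC -scalerA -scalerDr; congr (_ *: _).
rewrite scaler_sumr -big_split; apply: eq_bigr => i _ /=.
rewrite scaler_sumr -big_split; apply: eq_bigr => j _ /=.
by rewrite !mxE scalerDl -scalerA.
Qed.

HB.instance Definition _ :=
  GRing.isLinear.Build R _ _ _ (spin_lift c) lift_is_linear.

Lemma so7E B : so7 B -> forall i j, B j i = - B i j.
Proof. by rewrite /so7 => hB i j; have := congr1 (fun C : 'M[R]_7 => C i j) hB; rewrite !mxE. Qed.

Lemma lift_skew B : so7 B -> (spin_lift c B)^T = - spin_lift c B.
Proof.
move=> hB; rewrite /spin_lift trmxZ -scalerN; congr (_ *: _).
rewrite raddf_sum /= [in RHS]exchange_big -sumrN; apply: eq_bigr => i _ /=.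
rewrite raddf_sum -sumrN; apply: eq_bigr => j _ /=.
rewrite [LHS]trmxZ trmx_mul !cliff_tr mulmxN mulNmx opprK -scaleNr.
by rewrite (so7E hB j i).
Qed.

(** The commutator of c_i c_j with x is 2 x_i c_j - 2 x_j c_i. As B is skew, the
    two halves of the sum over i and j agree, and the factor 1/4 normalizes
    them. *)
Lemma lift_cl B x : so7 B ->
  spin_lift c B *m cl c x - cl c x *m spin_lift c B = cl c (x *m B).
Proof.
move=> hB.
have Bs := so7E hB.
have cij i j : c i *m c j *m cl c x - cl c x *m (c i *m c j)
    = (x 0 i *+ 2) *: c j - (x 0 j *+ 2) *: c i.
  have xi (l : 'I_7) : (x *m (delta_mx 0 l : 'rV[R]_7)^T) 0 0 = x 0 l.
    rewrite row_dot (bigD1 l) //= big1 => [|m ml]; rewrite !mxE ?eqxx ?mulr1 ?addr0 //.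
    by rewrite (negbTE ml) andbF mulr0.
  rewrite -!(cl_delta) -!mulmxA [cl c _ *m cl c x]clC mulmxA.
  rewrite mulmxBr mulmxN mulmxA [cl c (delta_mx 0 i) *m cl c x]clC !xi.
  rewrite mulmxBl mulNmx opprB opprK mul_scalar_mx mul_mx_scalar.
  by rewrite -!mulmxA; mxabel.
rewrite /spin_lift -scalemxAl -scalemxAr -scalerBr mulmx_suml mulmx_sumr -sumrB.
transitivity ((4^-1 : R) *: \sum_i \sum_j
    (B i j *: ((x 0 i *+ 2) *: c j) - B i j *: ((x 0 j *+ 2) *: c i))).
  congr (_ *: _); apply: eq_bigr => i _.
  rewrite mulmx_suml mulmx_sumr -sumrB; apply: eq_bigr => j _.
  by rewrite -scalemxAl -scalemxAr -!scalerBr cij.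
transitivity ((4^-1 : R) *: \sum_i \sum_j ((4 * (x 0 i * B i j)) *: c j)); last first.
  rewrite exchange_big scaler_sumr; apply: eq_bigr => j _ /=.
  rewrite mxE scaler_suml scaler_sumr.
  by apply: eq_bigr => i _; rewrite scalerA; congr (_ *: _); field.
congr (_ *: _).
under eq_bigr => i _ do rewrite sumrB.
rewrite sumrB [X in _ - X]exchange_big -sumrB; apply: eq_bigr => i _ /=.
rewrite -sumrB; apply: eq_bigr => j _.
rewrite !scalerA -scalerBl; congr (_ *: _); rewrite (Bs i j).
by rewrite -(mulr_natl (x 0 i)); ring.
Qed.

Lemma lift_cl_eq B x : so7 B ->
  spin_lift c B *m cl c x = cl c x *m spin_lift c B + cl c (x *m B).
Proof. by move=> hB; rewrite -lift_cl // addrC subrK. Qed.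

(** The difference of K and the lift of B commutes with all vectors, so
    [clifford_commutant_skew] applies. This is how elements of spin(7) are
    recognized: by their action on vectors, without writing them in terms of the
    c_i c_j. *)
Lemma skew_eq_lift (K : 'M[R]_8) B : so7 B -> K^T = - K ->
  (forall x, K *m cl c x - cl c x *m K = cl c (x *m B)) -> K = spin_lift c B.
Proof.
move=> hB hK h; apply/eqP; rewrite -subr_eq0; apply/eqP.
apply: clifford_commutant_skew.
  by rewrite raddfB /= hK lift_skew // opprB opprK addrC.
move=> i; rewrite mulmxBl mulmxBr -cl_delta; apply/eqP; rewrite -subr_eq0.
have := h (delta_mx 0 i); rewrite -lift_cl // => /eqP; rewrite -subr_eq0 => /eqP <-.
by apply/eqP; mxabel.
Qed.

Lemma so7_bracket A B : so7 A -> so7 B -> so7 (A *m B - B *m A).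
Proof.
move=> hA hB; rewrite /so7 raddfB /= !trmx_mul hA hB !mulmxN !mulNmx !opprK.
by rewrite opprB.
Qed.

(** The bracket is reversed because rotations act on rows from the right. *)
Lemma lift_bracket A B : so7 A -> so7 B ->
  spin_lift c A *m spin_lift c B - spin_lift c B *m spin_lift c A
  = spin_lift c (B *m A - A *m B).
Proof.
move=> hA hB; apply: skew_eq_lift; first exact: so7_bracket.
  rewrite raddfB /= !trmx_mul !lift_skew // !mulmxN !mulNmx !opprK.
  by rewrite opprB.
move=> x.
have hAx := lift_cl x hA; have hBx := lift_cl x hB.
have hAB := lift_cl (x *m A) hB; have hBA := lift_cl (x *m B) hA.
have -> : cl c (x *m (B *m A - A *m B)) = cl c (x *m B *m A) - cl c (x *m A *m B).
  by rewrite mulmxBr raddfB /= !mulmxA.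
rewrite -hAB -hBA -hAx -hBx.
rewrite !mulmxBl !mulmxBr !mulmxA.
by mxabel.
Qed.

(** * The 3-form of a unit spinor and the complement of g_2 *)

(** The 3-form (x, y, z) |-> <s, x y z s> of the G_2-structure defined by s,
    contracted with x. *)
Definition crossmx s x : 'M[R]_7 :=
  \matrix_(j, k) (s^T *m cl c x *m c j *m c k *m s) 0 0.

Lemma crossE s x j k : crossmx s x j k = dot s (cl c x *m (c j *m (c k *m s))).
Proof. by rewrite mxE /dot !mulmxA. Qed.

Lemma cross_is_linear s : linear (crossmx s).
Proof.
move=> a x y; apply/matrixP => j k; rewrite [RHS]mxE [in RHS]mxE !crossE.
by rewrite linearP /= mulmxDl -scalemxAl dotDr dotZr.
Qed.

HB.instance Definition _ s :=
  GRing.isLinear.Build R _ _ _ (crossmx s) (cross_is_linear s).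

Lemma cross_skew s x : so7 (crossmx s x).
Proof.
apply/matrixP => j k; rewrite [LHS]mxE [RHS]mxE !crossE.
rewrite [c k *m (c j *m s)]mulmxA cliffC mulmxBl mulNmx mulmxBr mulmxN dotBr dotNr.
by rewrite mul_scalar_mx -scalemxAr dotZr dot_cl mulr0 subr0 !mulmxA.
Qed.

(** Contraction with the 3-form is sqrt 6 times an isometry. For a = x . s and
    b = y . s, the entries are the products <c_j a, c_k s>, and the completeness
    relation [clifford_basis1] turns the sum over k, and then the one over j, into
    inner products of a, b and s. *)
Lemma cross_tr s x y : unit_spinor s ->
  \tr ((crossmx s x)^T *m crossmx s y) = 6 * (x *m y^T) 0 0.
Proof.
move=> hs.
pose a := cl c x *m s; pose b := cl c y *m s.
have sa : dot s a = 0 by apply: dot_cl.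
have sb : dot s b = 0 by apply: dot_cl.
have ab : dot a b = (x *m y^T) 0 0 by rewrite dot_clcl unit_dot // mulr1.
have E z j k : crossmx s z j k = dot (c j *m (cl c z *m s)) (c k *m s).
  by rewrite crossE dotMr cl_tr dotMr cliff_tr !mulNmx mulmxN opprK.
have expand (u v : 'cV[R]_8) : \sum_k dot u (c k *m s) * dot v (c k *m s)
    = dot u v - dot u s * dot v s.
  transitivity (dot u ((\sum_k (c k *m s) *m (c k *m s)^T) *m v)).
    rewrite mulmx_suml dot_sumr; apply: eq_bigr => k _.
    by rewrite -mulmxA dotE mul_mx_scalar dotZr (dotC v) mulrC.
  rewrite clifford_basis1 // mulmxBl mul1mx dotBr; congr (_ - _).
  by rewrite -mulmxA dotE mul_mx_scalar dotZr (dotC v) mulrC.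
rewrite mxtrace_dot.
transitivity (\sum_(j < 7) ((x *m y^T) 0 0 - dot a (c j *m s) * dot b (c j *m s))).
  apply: eq_bigr => j _.
  transitivity (\sum_k dot (c j *m a) (c k *m s) * dot (c j *m b) (c k *m s)).
    by apply: eq_bigr => k _; rewrite !E; ring.
  have cj u v : dot (c j *m u) (c j *m v) = dot u v.
    by rewrite dotMr mulmxA (cm_orth hc) mul1mx.
  have cjs u : dot (c j *m u) s = - dot u (c j *m s).
    by rewrite dotC dotMr cliff_tr mulNmx dotNl dotC.
  by rewrite expand cj ab !cjs; ring.
rewrite sumrB expand // ab (dotC a) sa mul0r subr0 sumr_const card_ord.
by rewrite -mulr_natl; ring.
Qed.

Lemma cross_inj s x : unit_spinor s -> crossmx s x = 0 -> x = 0.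
Proof.
move=> hs h; have := cross_tr x x hs; rewrite h mulmx0 raddf0 => /esym/eqP.
rewrite mulf_eq0 pnatr_eq0 /= => /eqP h0.
have : dot x^T x^T = 0 by rewrite /dot trmxK.
by move=> /dot_eq0 /(congr1 trmx); rewrite trmxK trmx0.
Qed.

(** The component of a lifted B . s along c_i s pairs B with the contraction of the
    3-form with e_i. Hence g_2 is the orthogonal complement of the image of
    [crossmx s]. *)
Lemma lift_spinor s B : unit_spinor s -> so7 B ->
  spin_lift c B *m s
  = - cl c (\row_i (4^-1 * \tr ((crossmx s (delta_mx 0 i))^T *m B))) *m s.
Proof.
move=> hs hB; rewrite {1}[LHS](spinor_expand _ hs) dot_skew ?lift_skew // scale0r add0r.
rewrite -raddfN /= /cl mulmx_suml; apply: eq_bigr => i _.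
rewrite -scalemxAl !mxE; congr (_ *: _).
rewrite /spin_lift -scalemxAl dotZr -mulrN; congr (_ * _).
rewrite mulmx_suml dot_sumr mxtrace_dot -sumrN; apply: eq_bigr => j _ /=.
rewrite mulmx_suml dot_sumr -sumrN; apply: eq_bigr => k _ /=.
rewrite -scalemxAl dotZr -mulNr mulrC; congr (_ * _).
by rewrite crossE (dotMr (cl c _)) cl_tr mulNmx dotNl opprK cl_delta !mulmxA.
Qed.

(** The complement m of g_2 is a copy of R^7. The factor 2/3 = 4/6 combines the
    1/4 of [lift_spinor] with the 6 of [cross_tr]; it makes C = B - crossmx s w
    orthogonal to the image of [crossmx s], that is an element of g_2. Then C is
    orthogonal to B and to crossmx s w, hence to itself. *)
Lemma g2_perp_cross s B y : unit_spinor s -> g2_perp c s B ->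
  spin_lift c B *m s = - (cl c y *m s) -> B = crossmx s ((2 / 3) *: y).
Proof.
move=> hs [hB hp]; rewrite lift_spinor // mulNmx => /oppr_inj /eqP.
rewrite -subr_eq0 -mulmxBl -raddfB => /eqP /(cl_inj hs) /eqP.
rewrite subr_eq0 => /eqP hy.
pose w := (2 / 3) *: y; pose C := B - crossmx s w.
have trC x : \tr ((crossmx s x)^T *m C) = 0.
  rewrite {1}(row_sum_delta x) raddf_sum raddf_sum mulmx_suml raddf_sum big1 // => i _ /=.
  rewrite linearZ /= trmxZ -scalemxAl mxtraceZ.
  rewrite mulmxBr raddfB /= cross_tr // row_dot (bigD1 i) //= big1 => [|l li]; last first.
    by rewrite mxE (negbTE li) andbF mul0r.
  have := congr1 (fun v : 'rV[R]_7 => v 0 i) hy; rewrite !mxE /= => <-; rewrite !eqxx /= mulr1n.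
  by field.
have hC : g2 c s C.
  split; first by rewrite /so7 raddfB /= hB (cross_skew s w) opprB opprK addrC.
  rewrite lift_spinor //; last first.
    by rewrite /so7 raddfB /= hB (cross_skew s w) opprB opprK addrC.
  have -> : \row_i (4^-1 * \tr ((crossmx s (delta_mx 0 i))^T *m C)) = 0.
    by apply/matrixP => k l; rewrite !mxE trC mulr0.
  by rewrite raddf0 oppr0 mul0mx.
apply/eqP; rewrite -subr_eq0; apply/eqP; apply: mxtrace_sq_eq0.
have CT : C^T = B^T - (crossmx s w)^T by rewrite /C raddfB.
by rewrite -/w -/C CT mulmxBl raddfB /= hp // trC subrr.
Qed.

Lemma spin_group_orth u : spin_group c u -> u^T *m u = 1%:M.
Proof.
elim=> [|x y v hx hy _ IH]; first by rewrite trmx1 mulmx1.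
have h z : z *m z^T = 1%:M -> (cl c z)^T *m cl c z = 1%:M.
  by move=> hz; rewrite cl_tr mulNmx cl_sq hz mxE eqxx raddfN opprK.
rewrite !trmx_mul -!mulmxA [(cl c x)^T *m _]mulmxA h // mul1mx.
by rewrite [(cl c y)^T *m _]mulmxA h // mul1mx.
Qed.

Lemma covers_mul u v Q T : covers c u Q -> covers c v T ->
  covers c (v *m u) (Q *m T).
Proof.
move=> hu hv x; rewrite -mulmxA hu mulmxA hv -!mulmxA.
by rewrite !mulmxA.
Qed.

(** The inverse differential of the covering is equivariant. *)
Lemma covers_lift u Q B : covers c u Q ->
  u *m spin_lift c B = spin_lift c (Q^T *m B *m Q) *m u.
Proof.
move=> hu.
have cc i j : u *m (c i *m c j) = cl c (row i Q) *m cl c (row j Q) *m u.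
  by rewrite -!cl_delta mulmxA hu -mulmxA hu mulmxA -!rowE.
rewrite /spin_lift -scalemxAr -scalemxAl; congr (_ *: _).
rewrite mulmx_sumr.
transitivity ((\sum_i \sum_j B i j *: (cl c (row i Q) *m cl c (row j Q))) *m u).
  rewrite mulmx_suml; apply: eq_bigr => i _; rewrite mulmx_sumr mulmx_suml.
  by apply: eq_bigr => j _; rewrite -scalemxAr -scalemxAl cc.
congr (_ *m _).
transitivity (\sum_i \sum_j \sum_k \sum_l
   (Q i k * B i j * Q j l) *: (c k *m c l)).
  apply: eq_bigr => i _; apply: eq_bigr => j _.
  rewrite /cl mulmx_suml scaler_sumr; apply: eq_bigr => k _.
  rewrite mulmx_sumr scaler_sumr; apply: eq_bigr => l _.
  rewrite -scalemxAl -scalemxAr !scalerA !mxE; congr (_ *: _); ring.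
under eq_bigr => i _.
  rewrite exchange_big; under eq_bigr => k _ do rewrite exchange_big; over.
rewrite exchange_big; apply: eq_bigr => k _ /=.
rewrite exchange_big; apply: eq_bigr => l _ /=.
rewrite mxE scaler_suml exchange_big; apply: eq_bigr => j _ /=.
rewrite mxE mulr_suml scaler_suml; apply: eq_bigr => i _.
by rewrite mxE.
Qed.

End Clifford.

(** * Differentiation and smoothness *)

Section Differentiation.
Variables (R : realType) (V : normedModType R).

Lemma near_eq_differentiable (W : normedModType R) (f g : V -> W) x :
  {near x, f =1 g} -> differentiable f x -> differentiable g x.
Proof.
move=> fg df; have fgx : f x = g x by exact: nbhs_singleton fg.
have H : g \o shift x = cst (g x) + 'd f x +o_ (0 : V) id.
  have /eqaddoP hf := diff_locally df.
  apply/eqaddoP => e e0; have := hf e e0.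
  have fg0 : \forall h \near (0 : V), f (h + x) = g (h + x).
    have cx : (fun h : V => h + x) @ (0 : V) --> 0 + x.
      by apply: cvgD; [exact: cvg_id|exact: cvg_cst].
    by rewrite add0r in cx; exact: cx _ fg.
  move=> he; near=> h.
  have -> : (g \o shift x - (cst (g x) + 'd f x)) h = (f \o shift x - (cst (f x) + 'd f x)) h.
    rewrite !fctE /= fgx; congr (_ - _); apply: esym.
    by near: h.
  by near: h.
have cdf : continuous ('d f x) by apply: diff_continuous.
have E := diff_unique cdf H.
by apply/diff_locallyP; rewrite E.
Unshelve. all: by end_near. Qed.

Lemma differentiable_mxP m n (f : V -> 'M[R]_(m, n)) x :
  differentiable f x <-> forall i j, differentiable (fun y => f y i j : R^o) x.
Proof.
split=> [df i j|df].
  apply: (differentiable_comp df (differentiable_coord _ i j)).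
have -> : f = \sum_(i < m) \sum_(j < n) (fun y => f y i j *: delta_mx i j).
  apply/funext => y; rewrite {1}(matrix_sum_delta (f y)) fct_sumE; apply: eq_bigr => i _.
  by rewrite fct_sumE.
apply: differentiable_sum => i; apply: differentiable_sum => j.
exact: differentiableZl.
Qed.

Lemma is_derive_mxP m n (f : V -> 'M[R]_(m, n)) x v df :
  is_derive x v f df <->
  forall i j, is_derive x v (fun y => f y i j : R^o) (df i j).
Proof.
split=> [[fx <-] i j|h].
  split; first by move/derivable_mxP : fx; apply.
  by rewrite derive_mx // mxE.
have fx : derivable f x v by apply/derivable_mxP => i j; case: (h i j).
split=> //; rewrite derive_mx //; apply/matrixP => i j; rewrite mxE.
by case: (h i j).
Qed.

Lemma is_derive_mulmx m n p (f : V -> 'M[R]_(m, n)) (g : V -> 'M[R]_(n, p)) x v df dg :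
  is_derive x v f df -> is_derive x v g dg ->
  is_derive x v (fun y => f y *m g y) (df *m g x + f x *m dg).
Proof.
move=> /is_derive_mxP hf /is_derive_mxP hg; apply/is_derive_mxP => i j.
have -> : (fun y => (f y *m g y) i j) = \sum_(k < n) (fun y => f y i k * g y k j).
  by apply/funext => y; rewrite mxE fct_sumE.
rewrite mxE [(df *m _) _ _]mxE [(f x *m _) _ _]mxE -big_split /=.
apply: is_derive_sum => k.
have := @is_deriveM R V _ _ x v _ _ (hf i k) (hg k j).
move=> /is_derive_eq; apply.
by rewrite addrC /GRing.scale /= [g x k j * _]mulrC.
Qed.

Lemma is_derive_trmx m n (f : V -> 'M[R]_(m, n)) x v df :
  is_derive x v f df -> is_derive x v (fun y => (f y)^T) df^T.
Proof.
move=> /is_derive_mxP hf; apply/is_derive_mxP => i j; rewrite mxE.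
have -> : (fun y => (f y)^T i j) = (fun y => f y j i) by apply/funext => y; rewrite mxE.
exact: hf.
Qed.

Lemma is_derive_linmx m n p q (L : {linear 'M[R]_(m, n) -> 'M[R]_(p, q)})
    (f : V -> 'M[R]_(m, n)) x v df :
  is_derive x v f df -> is_derive x v (fun y => L (f y)) (L df).
Proof.
move=> /is_derive_mxP hf; apply/is_derive_mxP => i j.
have E A : L A i j = \sum_(k < m) \sum_(l < n) L (delta_mx k l) i j *: A k l.
  rewrite {1}(matrix_sum_delta A) raddf_sum summxE; apply: eq_bigr => k _.
  rewrite raddf_sum summxE; apply: eq_bigr => l _.
  by rewrite /= linearZ mxE mulrC.
have -> : (fun y => L (f y) i j)
    = \sum_(k < m) \sum_(l < n) (fun y => L (delta_mx k l) i j *: (f y k l : R^o)).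
  apply/funext => y; rewrite E fct_sumE; apply: eq_bigr => k _.
  by rewrite fct_sumE.
rewrite E; by apply: is_derive_sum => k; apply: is_derive_sum => l.
Qed.

Lemma diff_is_derive (W : normedModType R) (f : V -> W) x v :
  differentiable f x -> is_derive x v f ('D_v f x).
Proof. by move=> df; exact/derivableP/diff_derivable. Qed.

Lemma deriveP (W : normedModType R) (f : V -> W) x v df :
  is_derive x v f df -> 'D_v f x = df.
Proof. by case. Qed.

End Differentiation.

Section Smooth.
Variables (R : realType) (V : normedModType R).

(** Smoothness by orders of differentiation, so that closure under algebraic
    operations follows by induction from the Leibniz rule. *)
Fixpoint ck (W : normedModType R) (k : nat) (U : set V) (f : V -> W) : Prop :=
  match k with
  | 0 => forall x, U x -> differentiable f x
  | k'.+1 => (forall x, U x -> differentiable f x) /\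
             forall v, ck k' U ('D_v f)
  end.

Definition smooth (W : normedModType R) (U : set V) (f : V -> W) : Prop :=
  forall k, ck k U f.

Section Generic.
Variable W : normedModType R.
Implicit Types (f g : V -> W) (U : set V).

Lemma ck_diff k U f x : ck k U f -> U x -> differentiable f x.
Proof. by case: k => [|k] => [|[+ _]]; apply. Qed.

Lemma smooth_diff U f x : smooth U f -> U x -> differentiable f x.
Proof. by move=> /(_ 0); apply. Qed.

Lemma smooth_derive U f v : smooth U f -> smooth U ('D_v f).
Proof. by move=> h k; have [_] := h k.+1; apply. Qed.

(** Links the recursive form to the one with a list of directions, in which
    smoothness on a manifold is given. *)
Lemma smoothP U f :
  (forall (s : seq V) x, U x ->
     differentiable (foldr (fun v h => 'D_v h) f s) x) <-> smooth U f.
Proof.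
split=> [h k|].
  elim: k f h => [|k IH] f h /=; first exact: (h [::]).
  split=> [|v]; first exact: (h [::]).
  by apply: IH => s x Ux; have := h (rcons s v) x Ux; rewrite foldr_rcons.
move=> + s; elim/last_ind: s f => [|s v IH] f h x Ux /=; first exact: smooth_diff Ux.
by rewrite foldr_rcons; apply: IH => //; exact: smooth_derive.
Qed.

Lemma ck_eq k U f g : open U -> (forall x, U x -> f x = g x) ->
  ck k U f -> ck k U g.
Proof.
move=> oU; elim: k f g => [|k IH] f g fg /=.
  move=> h x Ux; apply: near_eq_differentiable (h x Ux).
  by apply: filterS (open_nbhs_nbhs (conj oU Ux)) => y; exact: fg.
move=> [h1 h2]; split=> [x Ux|v].
  apply: near_eq_differentiable (h1 x Ux).
  by apply: filterS (open_nbhs_nbhs (conj oU Ux)) => y; exact: fg.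
apply: IH (h2 v) => x Ux; apply: near_eq_derive.
by apply: filterS (open_nbhs_nbhs (conj oU Ux)) => y; exact: fg.
Qed.

Lemma ckS k U f : ck k.+1 U f -> ck k U f.
Proof.
elim: k f => [|k IH] f [h1 h2] //=; split=> // v.
by apply: IH; exact: h2.
Qed.

Lemma ck_cst k U (a : W) : ck k U (cst a).
Proof.
elim: k a => [|k IH] a /=; first by move=> x _; exact: differentiable_cst.
split=> [x _|v]; first exact: differentiable_cst.
have -> : 'D_v (cst a) = cst 0 :> (V -> W) by apply/funext => x; rewrite derive_cst.
exact: IH.
Qed.

Lemma ckD k U f g : open U -> ck k U f -> ck k U g -> ck k U (f + g).
Proof.
move=> oU; elim: k f g => [|k IH] f g /=.
  by move=> hf hg x Ux; apply: differentiableD; [exact: hf|exact: hg].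
move=> [hf hf'] [hg hg']; split=> [x Ux|v].
  by apply: differentiableD; [exact: hf|exact: hg].
apply: (ck_eq _ _ (IH _ _ (hf' v) (hg' v))) => // x Ux.
rewrite -[RHS]/('D_v (f + g) x) deriveD //; apply: diff_derivable; [exact: hf|exact: hg].
Qed.

End Generic.

Section Scalar.
Implicit Types (f g : V -> R^o) (U : set V).

Lemma ckM k U f g : open U -> ck k U f -> ck k U g -> ck k U (f * g : V -> R^o).
Proof.
move=> oU; elim: k f g => [|k IH] f g hf hg.
  by move=> x Ux; apply: (@differentiableM R V f g); [exact: hf|exact: hg].
have hf' := ckS hf; have hg' := ckS hg.
split=> [x Ux|v].
  by apply: (@differentiableM R V f g); [exact: (ck_diff hf' Ux)|exact: (ck_diff hg' Ux)].
have [_ Df] := hf; have [_ Dg] := hg.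
have := ckD oU (IH _ _ hf' (Dg v)) (IH _ _ hg' (Df v)).
apply: ck_eq => // x Ux.
by rewrite [RHS](@deriveM R V f g) //; apply: diff_derivable;
  [exact: (ck_diff hf' Ux)|exact: (ck_diff hg' Ux)].
Qed.

Lemma ckV k U f : open U -> (forall x, U x -> f x != 0) -> ck k U f ->
  ck k U (fun x => (f x)^-1 : R^o).
Proof.
move=> oU f0; elim: k f f0 => [|k IH] f f0 hf.
  by move=> x Ux; apply: differentiableV (f0 x Ux); exact: hf.
have hf' := ckS hf; have [_ Df] := hf; have h := IH _ f0 hf'.
split=> [x Ux|v].
  by apply: differentiableV (f0 x Ux); exact: (ck_diff hf' Ux).
have := ckM oU (ckM oU (ck_cst k U (-1 : R^o)) (ckM oU h h)) (Df v).
apply: ck_eq => // x Ux.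
rewrite [RHS](@deriveV R V f) ?f0 //; last by apply: diff_derivable; exact: (ck_diff hf' Ux).
by rewrite /GRing.scale /= !fctE -exprVn expr2 mulN1r.
Qed.

End Scalar.

Lemma derive_entry m n (f : V -> 'M[R]_(m, n)) x v i j : differentiable f x ->
  'D_v f x i j = 'D_v (fun y => f y i j : R^o) x.
Proof. by move=> df; rewrite derive_mx ?mxE //; exact: diff_derivable. Qed.

Lemma ck_mxP k m n U (f : V -> 'M[R]_(m, n)) : open U ->
  ck k U f <-> forall i j, ck k U (fun y => f y i j : R^o).
Proof.
move=> oU; elim: k f => [|k IH] f.
  split=> [h i j x Ux|h x Ux]; last by apply/differentiable_mxP => i j; exact: h.
  by have /differentiable_mxP := h x Ux; apply.
split=> [[h1 h2] i j|h].
  split=> [x Ux|v]; first by have /differentiable_mxP := h1 x Ux; apply.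
  have /IH /(_ i j) := h2 v; apply: ck_eq => // x Ux.
  by rewrite derive_entry //; exact: h1.
have hf x : U x -> differentiable f x.
  by move=> Ux; apply/differentiable_mxP => i j; have [h1 _] := h i j; exact: h1.
split=> // v; apply/IH => i j; have [_ /(_ v)] := h i j.
by apply: ck_eq => // x Ux; rewrite derive_entry //; exact: hf.
Qed.

Section Closure.
Variable U : set V.
Hypothesis oU : open U.

Lemma smooth_eq (W : normedModType R) (f g : V -> W) :
  (forall x, U x -> f x = g x) -> smooth U f -> smooth U g.
Proof. by move=> fg h k; exact: ck_eq (h k). Qed.

Lemma smooth_cst (W : normedModType R) (a : W) : smooth U (fun=> a).
Proof. by move=> k; exact: ck_cst. Qed.

Lemma smoothD (W : normedModType R) (f g : V -> W) :
  smooth U f -> smooth U g -> smooth U (fun x => f x + g x).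
Proof. by move=> hf hg k; exact: ckD. Qed.

Lemma smooth_sum (W : normedModType R) (I : Type) (r : seq I) (F : I -> V -> W) :
  (forall i, smooth U (F i)) -> smooth U (fun x => \sum_(i <- r) F i x).
Proof.
move=> h; elim: r => [|i r IH].
  by apply: smooth_eq (smooth_cst 0) => x _; rewrite big_nil.
by apply: smooth_eq (smoothD (h i) IH) => x _; rewrite big_cons.
Qed.

Lemma smoothM (f g : V -> R^o) : smooth U f -> smooth U g ->
  smooth U (fun x => f x * g x : R^o).
Proof. by move=> hf hg k; exact: ckM. Qed.

Lemma smoothV (f : V -> R^o) : (forall x, U x -> f x != 0) -> smooth U f ->
  smooth U (fun x => (f x)^-1 : R^o).
Proof. by move=> f0 hf k; exact: ckV. Qed.

Lemma smooth_mxP m n (f : V -> 'M[R]_(m, n)) :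
  smooth U f <-> forall i j, smooth U (fun y => f y i j : R^o).
Proof.
split=> [h i j k|h k]; last by apply/ck_mxP => // i j; exact: h.
by have /(ck_mxP _ _ oU) := h k; apply.
Qed.

Lemma smooth_scale m n (a : V -> R^o) (f : V -> 'M[R]_(m, n)) :
  smooth U a -> smooth U f -> smooth U (fun x => a x *: f x).
Proof.
move=> ha /smooth_mxP hf; apply/smooth_mxP => i j.
by apply: smooth_eq (smoothM ha (hf i j)) => x _; rewrite mxE.
Qed.

Lemma smoothN m n (f : V -> 'M[R]_(m, n)) :
  smooth U f -> smooth U (fun x => - f x).
Proof.
move=> hf; apply: smooth_eq (smooth_scale (smooth_cst (-1 : R^o)) hf) => x _.
by rewrite scaleN1r.
Qed.

Lemma smoothB m n (f g : V -> 'M[R]_(m, n)) :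
  smooth U f -> smooth U g -> smooth U (fun x => f x - g x).
Proof. by move=> hf hg; apply: smoothD => //; exact: smoothN. Qed.

Lemma smooth_mulmx m n p (f : V -> 'M[R]_(m, n)) (g : V -> 'M[R]_(n, p)) :
  smooth U f -> smooth U g -> smooth U (fun x => f x *m g x).
Proof.
move=> /smooth_mxP hf /smooth_mxP hg; apply/smooth_mxP => i j.
apply: smooth_eq (smooth_sum (index_enum _) (fun k => smoothM (hf i k) (hg k j))).
by move=> x _; rewrite mxE.
Qed.

Lemma smooth_trmx m n (f : V -> 'M[R]_(m, n)) :
  smooth U f -> smooth U (fun x => (f x)^T).
Proof.
move=> /smooth_mxP hf; apply/smooth_mxP => i j.
by apply: smooth_eq (hf j i) => x _; rewrite mxE.
Qed.

Lemma smooth_linmx m n p q (L : {linear 'M[R]_(m, n) -> 'M[R]_(p, q)})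
    (f : V -> 'M[R]_(m, n)) :
  smooth U f -> smooth U (fun x => L (f x)).
Proof.
move=> /smooth_mxP hf.
have := smooth_sum (index_enum _) (fun k => smooth_sum (index_enum _) (fun l =>
  smooth_scale (hf k l) (smooth_cst (L (delta_mx k l))))).
apply: smooth_eq => x _.
rewrite [in RHS](matrix_sum_delta (f x)) raddf_sum; apply: eq_bigr => k _.
by rewrite raddf_sum; apply: eq_bigr => l _; rewrite /= linearZ.
Qed.

End Closure.
End Smooth.

(** * Symmetry of second derivatives *)

Section Schwarz.
Variables (R : realType) (V : normedModType R).
Implicit Types (f : V -> R^o) (U : set V) (x v w p : V).

Lemma is_derive_line (W : normedModType R) (f : V -> W) p v (t : R) :
  differentiable f (p + t *: v) ->
  is_derive t 1 (fun s : R => f (p + s *: v)) ('D_v f (p + t *: v)).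
Proof.
have E : (fun h : R => h^-1 *: (f (p + (h *: 1 + t) *: v) - f (p + t *: v)))
  = (fun h : R => h^-1 *: (f (h *: v + (p + t *: v)) - f (p + t *: v))).
  apply/funext => h; congr (_ *: (f _ - _)).
  by rewrite [h *: 1]mulr1 scalerDl addrCA.
move=> /(diff_derivable (v := v)) => df; split.
  by rewrite /derivable E.
by rewrite /derive E.
Qed.

Lemma mvt0 (G dG : R -> R) (h : R) : 0 < h ->
  (forall s : R, 0 <= s <= h -> is_derive s 1 G (dG s)) ->
  exists2 s : R, 0 <= s <= h & G h - G 0 = dG s * h.
Proof.
move=> h0 hG.
have dGo : forall s : R, s \in `]0, h[%R -> is_derive s 1 G (dG s).
  by move=> s /subset_itv_oo_cc; rewrite in_itv /=; exact: hG.
have cG : {within `[0, h], continuous G}.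
  apply: derivable_within_continuous => s; rewrite in_itv /= => hs.
  by have [] := hG s hs.
have [s hs E] := MVT_segment (ltW h0) dGo cG.
by exists s; [rewrite in_itv /= in hs|rewrite E subr0].
Qed.

(** The mean value theorem in the direction v, for the difference of f along w,
    and then in the direction w, for the derivative of f. *)
Lemma second_difference U f x v w (h : R) : open U -> smooth U f -> 0 < h ->
  (forall s t : R, 0 <= s <= h -> 0 <= t <= h -> U (x + s *: v + t *: w)) ->
  exists s t : R, [/\ 0 <= s <= h, 0 <= t <= h &
    f (x + h *: v + h *: w) - f (x + h *: v) - f (x + h *: w) + f x
    = h ^+ 2 * 'D_w ('D_v f) (x + s *: v + t *: w)].
Proof.
move=> oU sf h0 hU.
have h00 : (0 : R) <= 0 <= h by rewrite lexx ltW.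
have hhh : 0 <= h <= h by rewrite lexx ltW.
have Ux (s : R) : 0 <= s <= h -> U (x + s *: v).
  by move=> hs; have := hU s 0 hs h00; rewrite scale0r addr0.
have Ux' (s : R) : 0 <= s <= h -> U (x + h *: w + s *: v).
  by move=> hs; rewrite addrAC; exact: hU.
pose G (s : R) : R := f (x + h *: w + s *: v) - f (x + s *: v).
pose dG (s : R) : R := 'D_v f (x + h *: w + s *: v) - 'D_v f (x + s *: v).
have dGP (s : R) : 0 <= s <= h -> is_derive s 1 G (dG s).
  move=> hs; apply: is_deriveB; apply: is_derive_line; apply: smooth_diff sf _.
    exact: Ux'.
  exact: Ux.
have [s hs E1] := mvt0 h0 dGP.
have dGs : exists2 t : R, 0 <= t <= h & dG s = 'D_w ('D_v f) (x + s *: v + t *: w) * h.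
  have sdf := smooth_derive v sf.
  pose H (t : R) : R := 'D_v f (x + s *: v + t *: w).
  pose dH (t : R) : R := 'D_w ('D_v f) (x + s *: v + t *: w).
  have dHP (t : R) : 0 <= t <= h -> is_derive t 1 H (dH t).
    by move=> ht; apply: is_derive_line; apply: smooth_diff sdf _; exact: hU.
  have [t ht E2] := mvt0 h0 dHP.
  exists t => //; rewrite -[LHS]/('D_v f (x + h *: w + s *: v) - 'D_v f (x + s *: v)).
  by move: E2; rewrite /H /dH scale0r addr0 addrAC.
have [t ht E2] := dGs.
exists s, t; split=> //; move: E1; rewrite E2 /G !scale0r !addr0.
rewrite (addrAC x (h *: w)) => E1; rewrite expr2 [RHS]mulrC [RHS]mulrA -E1.
by rewrite opprB addrA addrAC.
Qed.

Lemma ltr_dist_join (a b a' b' e : R) :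
  a' = b' -> `|a - a'| < e -> `|b - b'| < e -> `|a - b| < e + e.
Proof.
move=> <- h1 h2; have -> : a - b = (a - a') - (b - a') by ring.
by apply: le_lt_trans (ler_normB _ _) _; exact: ltrD.
Qed.

(** The second difference of f is symmetric in v and w. By [second_difference] the
    two mixed derivatives therefore agree at points arbitrarily close to x, and
    both are continuous. *)
Lemma schwarz_scalar U f x v w : open U -> smooth U f -> U x ->
  'D_w ('D_v f) x = 'D_v ('D_w f) x.
Proof.
move=> oU sf Ux; apply/eqP/negPn/negP => ne.
pose A := 'D_w ('D_v f); pose B := 'D_v ('D_w f).
have cA : {for x, continuous A}.
  apply: differentiable_continuous; apply: smooth_diff Ux.
  exact/smooth_derive/smooth_derive.
have cB : {for x, continuous B}.
  apply: differentiable_continuous; apply: smooth_diff Ux.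
  exact/smooth_derive/smooth_derive.
pose e := `|A x - B x| / 2.
have e0 : 0 < e by rewrite divr_gt0 // normr_gt0 subr_eq0.
have nA : \forall y \near x, `|A x - A y| < e by move/cvgrPdist_lt : cA; apply.
have nB : \forall y \near x, `|B x - B y| < e by move/cvgrPdist_lt : cB; apply.
have nU : \forall y \near x, U y by exact: open_nbhs_nbhs.
have : nbhs x ([set y | `|A x - A y| < e] `&` ([set y | `|B x - B y| < e] `&` U)).
  exact: filterI nA (filterI nB nU).
move=> /nbhs_ballP [d /= d0 hd].
(* The step h keeps the parallelogram spanned by h v and h w inside the ball. *)
have [h h0 hh] : exists2 h : R, 0 < h & h * (`|v| + `|w|) < d.
  exists (d / (`|v| + `|w| + 1)); first by rewrite divr_gt0 // ltr_wpDl // addr_ge0.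
  rewrite mulrAC ltr_pdivrMr ?ltr_wpDl ?addr_ge0 // ltr_pM2l //.
  by rewrite ltrDl.
have near_pt (u1 u2 : V) (s t : R) : `|u1| + `|u2| = `|v| + `|w| ->
    0 <= s <= h -> 0 <= t <= h -> ball x d (x + s *: u1 + t *: u2).
  move=> hu /andP[s0 sh] /andP[t0 th].
  rewrite -ball_normE /ball_ /= -addrA opprD addNKr normrN.
  apply: le_lt_trans hh; rewrite -hu mulrDr.
  apply: le_trans (ler_normD _ _) _; rewrite !normrZ !ger0_norm //.
  by apply: lerD; apply: ler_wpM2r.
have [|s [t [hs ht E1]]] := second_difference (x := x) (v := v) (w := w) oU sf h0.
  by move=> s t hs ht; have [_ []] := hd _ (near_pt v w s t erefl hs ht).
have [|s' [t' [hs' ht' E2]]] := second_difference (x := x) (v := w) (w := v) oU sf h0.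
  by move=> s' t' hs' ht'; have [_ []] := hd _ (near_pt w v s' t' (addrC _ _) hs' ht').
have E : A (x + s *: v + t *: w) = B (x + s' *: w + t' *: v).
  have hn0 : h ^+ 2 != 0 by rewrite expf_neq0 // gt_eqF.
  have E12 : f (x + h *: v + h *: w) - f (x + h *: v) - f (x + h *: w) + f x
      = f (x + h *: w + h *: v) - f (x + h *: w) - f (x + h *: v) + f x.
    rewrite (addrAC x (h *: v) (h *: w)); congr (_ + f x).
    exact: addrAC.
  exact: (mulfI hn0 (etrans (esym E1) (etrans E12 E2))).
have [hA _] := hd _ (near_pt v w s t erefl hs ht).
have [_ [hB _]] := hd _ (near_pt w v s' t' (addrC _ _) hs' ht').
have := ltr_dist_join E hA hB.
by rewrite /e -splitr ltxx.
Qed.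

Lemma schwarz m n U (f : V -> 'M[R]_(m, n)) x v w : open U -> smooth U f -> U x ->
  'D_w ('D_v f) x = 'D_v ('D_w f) x.
Proof.
move=> oU sf Ux; apply/matrixP => i j.
have sfe := (smooth_mxP oU f).1 sf i j.
have E (u u' : V) : 'D_u ('D_u' f) x i j = 'D_u ('D_u' (fun y => f y i j : R^o)) x.
  rewrite derive_entry; last by apply: smooth_diff Ux; exact: smooth_derive.
  apply: near_eq_derive.
  apply: filterS (open_nbhs_nbhs (conj oU Ux)) => y Uy.
  by rewrite derive_entry //; exact: smooth_diff Uy.
exact: etrans (E w v) (etrans (schwarz_scalar v w oU sfe Ux) (esym (E v w))).
Qed.

Lemma ball_derive0_const f x (d : R) : 0 < d ->
  (forall y, ball x d y -> differentiable f y) ->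
  (forall y v, ball x d y -> 'D_v f y = 0) ->
  forall y, ball x d y -> f y = f x.
Proof.
move=> d0 df Df y xy.
have seg (t : R) : 0 <= t <= 1 -> ball x d (x + t *: (y - x)).
  move=> /andP[t0 t1]; move: xy; rewrite -!ball_normE /ball_ /= opprD addNKr normrN normrZ.
  rewrite distrC ger0_norm //; apply: le_lt_trans; exact: ler_piMl.
have D (t : R) : 0 <= t <= 1 ->
    is_derive t 1 (fun t : R => f (x + t *: (y - x))) ('D_(y - x) f (x + t *: (y - x))).
  by move=> ht; apply: is_derive_line; apply: df; exact: seg.
have [t ht] := mvt0 ltr01 D; rewrite Df; last exact: seg.
by rewrite mul0r scale1r scale0r addr0 addrCA subrr addr0 => /eqP; rewrite subr_eq0 => /eqP.
Qed.

End Schwarz.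

(** * Clifford contractions of curvature terms *)

Section Curvature.
Variables (R : realType) (c : 'I_7 -> 'M[R]_8).
Hypothesis hc : clifford_module c.

Lemma sum_delta (W : lmodType R) (n : nat) (i : 'I_n) (f : 'I_n -> W) :
  \sum_j (i == j)%:R *: f j = f i.
Proof.
rewrite (bigD1 i) //= eqxx scale1r big1 ?addr0 // => j ji.
by rewrite eq_sym (negbTE ji) scale0r.
Qed.

(** The products c_j c_k are antisymmetric off the diagonal. *)
Lemma sym_cliff_sum (B : 'M[R]_7) : B^T = B ->
  \sum_j c j *m cl c (row j B) = (- \tr B)%:M.
Proof.
move=> hB; have Bs i j : B j i = B i j by rewrite -[in RHS]hB mxE.
have E : \sum_j c j *m cl c (row j B) = \sum_j \sum_k B j k *: (c j *m c k).
  apply: eq_bigr => j _; rewrite /cl mulmx_sumr; apply: eq_bigr => k _.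
  by rewrite -scalemxAr mxE.
apply: (mulS_inj (n := 1)); rewrite mulr2n E {2}exchange_big -big_split /=.
transitivity (\sum_j \sum_k (j == k)%:R *: ((- (B j k *+ 2))%:M : 'M[R]_8)).
  apply: eq_bigr => j _; rewrite -big_split; apply: eq_bigr => k _ /=.
  rewrite (Bs j k) -scalerDr (cm_rel hc) !scale_scalar_mx; congr _%:M.
  by rewrite !mulrN mulrnAr -mulrnAl mulrC.
rewrite (eq_bigr (fun j => (- (B j j *+ 2))%:M)) => [|j _]; last first.
  by rewrite (sum_delta j (fun k => (- (B j k *+ 2))%:M)).
by rewrite -raddf_sum -raddfMn /= sumrN sumrMnl mulNrn.
Qed.

(** Anticommuting c_i and c_j brings each index next to its partner in f, at the
    cost of the diagonal terms. *)
Lemma sum_cliff_swap (f : 'I_7 -> 'I_7 -> 'M[R]_8) :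
  \sum_i \sum_j c i *m c j *m f i j
  = - (\sum_j c j *m \sum_i c i *m f i j) - (\sum_i f i i) *+ 2.
Proof.
transitivity (\sum_i \sum_j (- (c j *m (c i *m f i j)) - (i == j)%:R *: (f i j *+ 2))).
  apply: eq_bigr => i _; apply: eq_bigr => j _.
  rewrite (cliffC hc j i) mulmxBl mulNmx -mulmxA; congr (_ - _).
  by rewrite mul_scalar_mx eq_sym -[f i j *+ 2](scaler_nat 2) scalerA mulr_natr.
have S i : \sum_j (- (c j *m (c i *m f i j)) - (i == j)%:R *: (f i j *+ 2))
    = - (\sum_j c j *m (c i *m f i j)) - f i i *+ 2.
  by rewrite sumrB sumrN (sum_delta i (fun j => f i j *+ 2)).
rewrite (eq_bigr _ (fun i _ => S i)) sumrB sumrN sumrMnl; congr (- _ - _).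
rewrite exchange_big; apply: eq_bigr => j _ /=.
by rewrite mulmx_sumr.
Qed.

(** For N i = nabla_{e_i} S, this contracts the right-hand side of the curvature
    identity of a spinor. Every sum of c_j times the j-th row of one of the
    symmetric traceless matrices vanishes by [sym_cliff_sum]. Where j is not next
    to its row, [sum_cliff_swap] applies, and its diagonal terms are div S and
    |S|^2. *)
Lemma dirac_contraction (N : 'I_7 -> 'M[R]_7) (S : 'M[R]_7) :
  (forall i, (N i)^T = N i) -> (forall i, \tr (N i) = 0) ->
  S^T = S -> \tr S = 0 ->
  exists b : R, \sum_i \sum_j c i *m c j *m
     (cl c (row j (N i) - row i (N j))
      + (cl c (row j S) *m cl c (row i S) - cl c (row i S) *m cl c (row j S)))
   = cl c (\sum_i row i (N i)) *+ 2 + b%:M.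
Proof.
move=> hN tN hS tS.
have cN i : \sum_j c j *m cl c (row j (N i)) = 0.
  by rewrite sym_cliff_sum // tN oppr0 raddf0.
have cS : \sum_j c j *m cl c (row j S) = 0.
  by rewrite sym_cliff_sum // tS oppr0 raddf0.
have E1 : \sum_i \sum_j c i *m c j *m cl c (row j (N i)) = 0.
  rewrite big1 // => i _; under eq_bigr => j _ do rewrite -mulmxA.
  by rewrite -mulmx_sumr cN mulmx0.
have E2 : \sum_i \sum_j c i *m c j *m cl c (row i (N j))
    = - (cl c (\sum_i row i (N i)) *+ 2).
  rewrite sum_cliff_swap big1 => [|j _]; last by rewrite cN mulmx0.
  by rewrite oppr0 sub0r raddf_sum.
have E3 : \sum_i \sum_j c i *m c j *m (cl c (row j S) *m cl c (row i S)) = 0.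
  rewrite big1 // => i _; under eq_bigr => j _ do rewrite -mulmxA (mulmxA (c j)).
  by rewrite -mulmx_sumr -mulmx_suml cS mul0mx mulmx0.
have E4 : \sum_i \sum_j c i *m c j *m (cl c (row i S) *m cl c (row j S))
    = (\sum_i (row i S *m (row i S)^T) 0 0 *+ 2)%:M.
  rewrite sum_cliff_swap big1 => [|j _]; last first.
    under eq_bigr => i _ do rewrite mulmxA.
    by rewrite -mulmx_suml cS mul0mx mulmx0.
  rewrite oppr0 sub0r sumrMnl [RHS]raddfMn /= -mulNrn; congr (_ *+ 2).
  rewrite [RHS]raddf_sum -sumrN; apply: eq_bigr => i _ /=.
  by rewrite (cl_sq hc) raddfN opprK.
exists (- (\sum_i (row i S *m (row i S)^T) 0 0 *+ 2)).
pose s2 (f : 'I_7 -> 'I_7 -> 'M[R]_8) := \sum_i \sum_j c i *m c j *m f i j.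
have s2B f h : s2 f - s2 h = s2 (fun i j => f i j - h i j).
  rewrite -sumrB; apply: eq_bigr => i _; rewrite -sumrB; apply: eq_bigr => j _.
  by rewrite -mulmxBr.
have s2D f h : s2 f + s2 h = s2 (fun i j => f i j + h i j).
  rewrite -big_split; apply: eq_bigr => i _; rewrite -big_split; apply: eq_bigr => j _ /=.
  by rewrite -mulmxDr.
transitivity (s2 (fun i j => cl c (row j (N i))) - s2 (fun i j => cl c (row i (N j)))
   + (s2 (fun i j => cl c (row j S) *m cl c (row i S))
      - s2 (fun i j => cl c (row i S) *m cl c (row j S)))).
  rewrite !s2B s2D; apply: eq_bigr => i _; apply: eq_bigr => j _.
  by rewrite raddfB.
rewrite /s2 E1 E2 E3 E4 sub0r opprK sub0r; congr (_ + _).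
by rewrite [RHS]raddfN.
Qed.

Lemma exch3 (W : zmodType) (f : 'I_7 -> 'I_7 -> 'I_7 -> W) :
  \sum_i \sum_j \sum_k f j k i = \sum_i \sum_j \sum_k f i j k.
Proof.
rewrite exchange_big; apply: eq_bigr => i _ /=.
by rewrite exchange_big.
Qed.

(** The contraction Q over three indices is averaged over their cyclic
    permutations. Reordering the factors c_i c_j c_k costs diagonal terms, which
    sum up to the Ricci matrix r, while the main terms cancel by the first Bianchi
    identity. As r is symmetric, the last contraction leaves its trace. *)
Lemma lichnerowicz_scalar (Om : 'I_7 -> 'I_7 -> 'M[R]_7) :
  (forall i j, so7 (Om i j)) -> (forall i j, Om j i = - Om i j) ->
  (forall i j k l, Om i j k l + Om j k i l + Om k i j l = 0) ->
  exists b : R, \sum_i \sum_j c i *m c j *m spin_lift c (Om i j) = b%:M.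
Proof.
move=> hs ha hb.
have sk i j k l : Om i j l k = - Om i j k l := so7E (hs i j) k l.
have an i j k l : Om j i k l = - Om i j k l by rewrite ha mxE.
have dg i k l : Om i i k l = 0 by have := an i i k l; lra.
(* The Ricci matrix. *)
pose r : 'M[R]_7 := \matrix_(k, l) \sum_i Om i k i l.
have rs : r^T = r.
  apply/matrixP => k l; rewrite !mxE; apply/eqP; rewrite -subr_eq0 -sumrB.
  apply/eqP/big1 => i _.
  have := hb i k l i; have := sk k l i i; have := sk i k i l; have := an i l k i.
  by have := sk i l i k; lra.
pose Q l := \sum_i \sum_j \sum_k Om i j k l *: (c i *m c j *m c k).
have QE l : Q l = (\sum_k r k l *: c k) *+ 2.
  pose T i j k := Om i j k l *: (c i *m c j *m c k).
  (* The diagonal terms that arise when c_j c_k c_i and c_k c_i c_j are brought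
     to the order c_i c_j c_k. *)
  pose D1 i j k : 'M[R]_8 := (i == j)%:R *: (Om j k i l *: c k).
  pose D2 i j k : 'M[R]_8 := (i == k)%:R *: (Om j k i l *: c j).
  pose D3 i j k : 'M[R]_8 := (j == k)%:R *: (Om k i j l *: c i).
  pose D4 i j k : 'M[R]_8 := (i == k)%:R *: (Om k i j l *: c j).
  have cyc i j k : T i j k + T j k i + T k i j
      = (D1 i j k - D2 i j k + D3 i j k - D4 i j k) *+ 2.
    have e1 : c j *m c k *m c i = c i *m c j *m c k
       + ((i == j)%:R *: c k - (i == k)%:R *: c j) *+ 2.
      rewrite -mulmxA (cliffC hc i k) mulmxBr mulmxN mulmxA (cliffC hc i j).
      rewrite mulmxBl mulNmx mul_scalar_mx mul_mx_scalar.
      by move: ((i == j)%:R : R) ((i == k)%:R : R) => d1 d2; mxabel.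
    have e2 : c k *m c i *m c j = c i *m c j *m c k
       + ((j == k)%:R *: c i - (i == k)%:R *: c j) *+ 2.
      rewrite (cliffC hc i k) mulmxBl mulNmx -(mulmxA (c i) (c k)) (cliffC hc j k) mulmxBr mulmxN.
      rewrite mul_scalar_mx mul_mx_scalar mulmxA.
      by move: ((j == k)%:R : R) ((i == k)%:R : R) => d1 d2; mxabel.
    rewrite /T e1 e2 /D1 /D2 /D3 /D4.
    have h : Om i j k l = - Om j k i l - Om k i j l by have := hb i j k l; lra.
    rewrite h; move: ((i == j)%:R : R) ((i == k)%:R : R) ((j == k)%:R : R) => d1 d2 d3.
    by mxabel.
  have Q3 : Q l *+ 3 = \sum_i \sum_j \sum_k (D1 i j k - D2 i j k + D3 i j k - D4 i j k) *+ 2.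
    have t1 : Q l = \sum_i \sum_j \sum_k T j k i by rewrite (exch3 T).
    have t2 : Q l = \sum_i \sum_j \sum_k T k i j by exact: (exch3 (fun i j k => T k i j)).
    rewrite 2!mulrS mulr1n {2}t1 {2}t2 /Q -!big_split; apply: eq_bigr => i _ /=.
    rewrite -!big_split; apply: eq_bigr => j _ /=.
    rewrite -!big_split; apply: eq_bigr => k _ /=.
    by rewrite -cyc addrA.
  have rE k : r k l *: c k = \sum_i Om i k i l *: c k by rewrite mxE scaler_suml.
  have S1 : \sum_i \sum_j \sum_k D1 i j k = \sum_k r k l *: c k.
    rewrite (eq_bigr _ (fun k _ => rE k)) [RHS]exchange_big; apply: eq_bigr => i _ /=.
    rewrite exchange_big; apply: eq_bigr => k _ /=.
    by rewrite (sum_delta i (fun j => Om j k i l *: c k)).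
  have S2 : \sum_i \sum_j \sum_k D2 i j k = - \sum_k r k l *: c k.
    rewrite (eq_bigr _ (fun k _ => rE k)) [in RHS]exchange_big -sumrN.
    apply: eq_bigr => i _ /=; rewrite -sumrN; apply: eq_bigr => j _.
    by rewrite (sum_delta i (fun k => Om j k i l *: c j)) -scaleNr -an.
  have S3 : \sum_i \sum_j \sum_k D3 i j k = \sum_k r k l *: c k.
    rewrite (eq_bigr _ (fun k _ => rE k)); apply: eq_bigr => i _.
    apply: eq_bigr => j _.
    by rewrite (sum_delta j (fun k => Om k i j l *: c i)).
  have S4 : \sum_i \sum_j \sum_k D4 i j k = 0.
    rewrite big1 // => i _; rewrite big1 // => j _.
    by rewrite (sum_delta i (fun k => Om k i j l *: c j)) dg scale0r.
  have split3 (F G : 'I_7 -> 'I_7 -> 'I_7 -> 'M[R]_8) :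
      \sum_i \sum_j \sum_k (F i j k + G i j k)
      = \sum_i \sum_j \sum_k F i j k + \sum_i \sum_j \sum_k G i j k.
    rewrite -big_split; apply: eq_bigr => i _; rewrite -big_split.
    by apply: eq_bigr => j _; rewrite -big_split.
  have opp3 (F : 'I_7 -> 'I_7 -> 'I_7 -> 'M[R]_8) :
      \sum_i \sum_j \sum_k (- F i j k) = - \sum_i \sum_j \sum_k F i j k.
    rewrite -sumrN; apply: eq_bigr => i _; rewrite -sumrN.
    by apply: eq_bigr => j _; rewrite -sumrN.
  have {}Q3 : Q l *+ 3 = (\sum_k r k l *: c k) *+ 2 *+ 3.
    rewrite Q3; transitivity ((\sum_i \sum_j \sum_k
        (D1 i j k - D2 i j k + D3 i j k - D4 i j k)) *+ 2).
      rewrite -sumrMnl; apply: eq_bigr => i _; rewrite -sumrMnl.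
      by apply: eq_bigr => j _; rewrite -sumrMnl.
    rewrite !split3 !opp3 S1 S2 S3 S4 -mulrnA mulnC mulrnA; congr (_ *+ 2).
    by rewrite opprK oppr0 addr0 2!mulrS mulr1n addrA.
  exact: mulS_inj Q3.
exists (- (2^-1 * \tr r)).
have -> : \sum_i \sum_j c i *m c j *m spin_lift c (Om i j) = 4^-1 *: \sum_l Q l *m c l.
  have F (i j : 'I_7) : c i *m c j *m spin_lift c (Om i j)
      = 4^-1 *: \sum_l \sum_k (Om i j k l *: (c i *m c j *m c k)) *m c l.
    rewrite /spin_lift -scalemxAr; congr (_ *: _).
    rewrite exchange_big mulmx_sumr; apply: eq_bigr => k _ /=.
    rewrite mulmx_sumr; apply: eq_bigr => l _.
    by rewrite -scalemxAl -scalemxAr !mulmxA.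
  transitivity ((4^-1 : R) *: \sum_i \sum_j \sum_l \sum_k
      (Om i j k l *: (c i *m c j *m c k)) *m c l).
    rewrite scaler_sumr; apply: eq_bigr => i _; rewrite scaler_sumr.
    by apply: eq_bigr => j _; rewrite F.
  congr (_ *: _); rewrite -exch3; apply: eq_bigr => l _.
  rewrite /Q mulmx_suml; apply: eq_bigr => i _; rewrite mulmx_suml.
  by apply: eq_bigr => j _; rewrite mulmx_suml.
have -> : \sum_l Q l *m c l = (\sum_l (\sum_k r k l *: c k) *m c l) *+ 2.
  by rewrite -sumrMnl; apply: eq_bigr => l _; rewrite QE !mulr2n mulmxDl.
have -> : \sum_l (\sum_k r k l *: c k) *m c l = (- \tr r)%:M.
  rewrite -sym_cliff_sum //.
  transitivity (\sum_k \sum_l r k l *: (c k *m c l)).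
    rewrite exchange_big; apply: eq_bigr => l _ /=; rewrite mulmx_suml.
    by apply: eq_bigr => k _; rewrite -scalemxAl.
  apply: eq_bigr => k _; rewrite /cl mulmx_sumr; apply: eq_bigr => l _.
  by rewrite -scalemxAr [row k r _ _]mxE.
rewrite -raddfMn /= scale_scalar_mx; congr _%:M.
by rewrite -mulr_natr; field.
Qed.

End Curvature.

(** * The Levi-Civita connection in a moving frame *)

Section LeviCivita.
Variable R : realType.
Notation V := ('rV[R]_7).

(** The Levi-Civita connection in one chart, for a metric gg on an open set. *)
Definition christoffel (gg : V -> 'M[R]_7) (y : V) (i : 'I_7) : 'M[R]_7 :=
  \matrix_(j, k) (2^-1 * \sum_l
    ('D_(basis_vec R i) gg y j l + 'D_(basis_vec R j) gg y i l
     - 'D_(basis_vec R l) gg y i j) * invmx (gg y) l k).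

Definition lcmx (gg : V -> 'M[R]_7) (v y : V) : 'M[R]_7 :=
  \sum_i v 0 i *: christoffel gg y i.

End LeviCivita.

(** The connection form of the frame F. It and [coframe] are locked to keep
    unification from unfolding products of matrix fields. *)
HB.lock Definition lcform (R : realType) (gg F : 'rV[R]_7 -> 'M[R]_7)
    (v y : 'rV[R]_7) : 'M[R]_7 :=
  ('D_v F y + F y *m lcmx gg v y) *m gg y *m (F y)^T.

(** The inverse of an orthonormal frame F, in a form that is visibly smooth. *)
HB.lock Definition coframe (R : realType) (gg F : 'rV[R]_7 -> 'M[R]_7)
    (y : 'rV[R]_7) : 'M[R]_7 := gg y *m (F y)^T.

Section LocalGeometry.
Variable R : realType.
Notation V := ('rV[R]_7).

(** The covariant derivative of an endomorphism field: (nabla_v S)(w) is the row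
    w *m nabla_endo gg S v y. *)
Definition nabla_endo (gg S : V -> 'M[R]_7) (v y : V) : 'M[R]_7 :=
  'D_v S y + S y *m lcmx gg v y - lcmx gg v y *m S y.

Lemma derive_dir_sum (W : normedModType R) (f : V -> W) y (v : V) :
  differentiable f y -> 'D_v f y = \sum_i v 0 i *: 'D_(basis_vec R i) f y.
Proof.
move=> df; rewrite deriveE // {1}(row_sum_delta v) raddf_sum; apply: eq_bigr => i _.
by rewrite /= linearZ deriveE.
Qed.

Variables (U : set V) (gg F : V -> 'M[R]_7).
Hypotheses (oU : open U) (sg : smooth U gg) (sF : smooth U F).
Hypothesis gsym : forall y, U y -> (gg y)^T = gg y.
Hypothesis Fon : forall y, U y -> F y *m gg y *m (F y)^T = 1%:M.
Implicit Types (v w y : V).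

Notation G := (lcmx gg).
Notation om := (lcform gg F).
Notation Finv := (coframe gg F).

Lemma FFinv y : U y -> F y *m Finv y = 1%:M.
Proof. by move=> Uy; rewrite coframe.unlock mulmxA Fon. Qed.

Lemma FinvF y : U y -> Finv y *m F y = 1%:M.
Proof. by move=> Uy; apply: mulmx1C; exact: FFinv. Qed.

Lemma invmx_metric y : U y -> invmx (gg y) = (F y)^T *m F y.
Proof.
move=> Uy; have h : gg y *m ((F y)^T *m F y) = 1%:M by have := FinvF Uy; rewrite coframe.unlock mulmxA.
have [ug _] := mulmx1_unit h.
by rewrite -[RHS]mul1mx -(mulVmx ug) -mulmxA h mulmx1.
Qed.

Lemma metric_unit y : U y -> gg y \in unitmx.
Proof.
move=> Uy; have h : gg y *m ((F y)^T *m F y) = 1%:M by have := FinvF Uy; rewrite coframe.unlock mulmxA.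
by have [] := mulmx1_unit h.
Qed.

Lemma smooth_Finv : smooth U Finv.
Proof. by rewrite coframe.unlock; apply: smooth_mulmx => //; exact: smooth_trmx. Qed.

Lemma smooth_lcmx v : smooth U (G v).
Proof.
apply: smooth_sum => // i; apply: smooth_scale => //; first exact: smooth_cst.
have sI : smooth U (fun y => invmx (gg y)).
  have : smooth U (fun y => (F y)^T *m F y).
    by apply: smooth_mulmx => //; exact: smooth_trmx.
  by apply: smooth_eq => // y Uy; rewrite invmx_metric.
apply/smooth_mxP => // j k.
have e (h : V -> 'M[R]_7) a b : smooth U h -> smooth U (fun y => h y a b : R^o).
  by move=> /(smooth_mxP oU); apply.
have : smooth U (fun y => 2^-1 * \sum_l
    ('D_(basis_vec R i) gg y j l + 'D_(basis_vec R j) gg y i l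
     + (-1) * 'D_(basis_vec R l) gg y i j) * invmx (gg y) l k : R^o).
  apply: smoothM => //; first exact: smooth_cst.
  apply: smooth_sum => // l; apply: smoothM => //; last exact: e.
  apply: smoothD => //; last first.
    by apply: smoothM => //; [exact: smooth_cst|apply/e/smooth_derive].
  by apply: smoothD => //; apply/e/smooth_derive.
apply: smooth_eq => // y _; rewrite mxE; congr (_ * _); apply: eq_bigr => l _.
by rewrite mulN1r.
Qed.

Lemma smooth_lcform v : smooth U (om v).
Proof.
rewrite lcform.unlock.
apply: smooth_mulmx => //; last exact: smooth_trmx.
apply: smooth_mulmx => //; apply: smoothD => //; first exact: smooth_derive.
by apply: smooth_mulmx => //; exact: smooth_lcmx.
Qed.

Lemma metric_derive_sym v y : U y -> ('D_v gg y)^T = 'D_v gg y.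
Proof.
move=> Uy; have h := is_derive_trmx (diff_is_derive v (smooth_diff sg Uy)).
rewrite -(deriveP h); apply: near_eq_derive.
by apply: filterS (open_nbhs_nbhs (conj oU Uy)) => z; exact: gsym.
Qed.

(** Names the first derivatives of the metric, so that [ring] and [field] meet
    numbers only. *)
Lemma christoffel_entries y : U y -> exists d : 'I_7 -> 'I_7 -> 'I_7 -> R,
  [/\ forall i j k, d i j k = d i k j,
      forall i j k, christoffel gg y i j k
        = 2^-1 * \sum_l (d i j l + d j i l - d l i j) * invmx (gg y) l k
    & forall i, 'D_(basis_vec R i) gg y = \matrix_(j, k) d i j k].
Proof.
move=> Uy; exists (fun i j k => 'D_(basis_vec R i) gg y j k); split.
- by move=> i j k; rewrite -{1}(metric_derive_sym _ Uy) mxE.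
- by move=> i j k; rewrite mxE.
- by move=> i; apply/matrixP => j k; rewrite mxE.
Qed.

Lemma lcmx_torsion_free v w y : U y -> w *m G v y = v *m G w y.
Proof.
move=> Uy; have [d [ds dC _]] := christoffel_entries Uy.
apply/matrixP => o k; rewrite ord1 !mxE.
transitivity (\sum_j \sum_i (w 0 j * v 0 i) * christoffel gg y i j k).
  apply: eq_bigr => j _; rewrite summxE mulr_sumr; apply: eq_bigr => i _.
  by rewrite mxE mulrA.
rewrite exchange_big; apply: eq_bigr => i _; rewrite summxE mulr_sumr.
apply: eq_bigr => j _; rewrite [in RHS]mxE mulrCA mulrA; congr (_ * _).
rewrite !dC; congr (_ * _); apply: eq_bigr => l _; congr (_ * _).
by rewrite (ds l j i); ring.
Qed.

Lemma lcmx_metric v y : U y -> 'D_v gg y = G v y *m gg y + gg y *m (G v y)^T.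
Proof.
move=> Uy; have [d [ds dC dD]] := christoffel_entries Uy.
have C i j m : (christoffel gg y i *m gg y) j m
    = 2^-1 * (d i j m + d j i m - d m i j).
  pose B : 'M[R]_7 := \matrix_(j, l) (d i j l + d j i l - d l i j).
  have -> : christoffel gg y i = 2^-1 *: (B *m invmx (gg y)).
    apply/matrixP => j' k; rewrite dC [RHS]mxE [in RHS]mxE; congr (_ * _).
    by apply: eq_bigr => l _; rewrite mxE.
  by rewrite -scalemxAl mulmxKV ?metric_unit // !mxE.
have -> : gg y *m (G v y)^T = (G v y *m gg y)^T by rewrite trmx_mul gsym.
rewrite (derive_dir_sum v (smooth_diff sg Uy)) /lcmx mulmx_suml raddf_sum -big_split.
apply: eq_bigr => i _ /=; rewrite -scalemxAl trmxZ -scalerDr dD; congr (_ *: _).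
apply/matrixP => j m; rewrite [LHS]mxE [RHS]mxE [X in _ + X]mxE !C.
by rewrite (ds i m j); field.
Qed.

Lemma lcform_frame v y : U y -> om v y *m F y = 'D_v F y + F y *m G v y.
Proof.
move=> Uy; transitivity (('D_v F y + F y *m G v y) *m (Finv y *m F y)).
  by rewrite lcform.unlock coframe.unlock !mulmxA.
by rewrite FinvF // mulmx1.
Qed.

Lemma frame_derive v y : U y -> is_derive y v F (om v y *m F y - F y *m G v y).
Proof.
move=> Uy; rewrite lcform_frame // addrK; apply: diff_is_derive.
exact: smooth_diff Uy.
Qed.

(** The derivative of the identity I F = 1. *)
Lemma coframe_derive v y : U y ->
  is_derive y v Finv (G v y *m Finv y - Finv y *m om v y).
Proof.
move=> Uy; have dI := diff_is_derive v (smooth_diff smooth_Finv Uy).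
have := is_derive_mulmx dI (frame_derive v Uy).
have n1 : \forall z \near y, Finv z *m F z = 1%:M.
  by apply: filterS (open_nbhs_nbhs (conj oU Uy)) => z; exact: FinvF.
move=> /(near_eq_is_derive n1) /deriveP; rewrite derive_cst => /esym h.
suff -> : G v y *m Finv y - Finv y *m om v y = 'D_v Finv y by [].
have := congr1 (mulmx^~ (Finv y)) h; rewrite mul0mx mulmxDl -(mulmxA ('D_v Finv y)) FFinv // mulmx1.
have -> : Finv y *m (om v y *m F y - F y *m G v y) *m Finv y
    = Finv y *m om v y - G v y *m Finv y.
  rewrite mulmxBr mulmxBl !mulmxA FinvF // mul1mx.
  by rewrite -(mulmxA (Finv y *m om v y)) FFinv // mulmx1.
by move=> /eqP; rewrite addr_eq0 opprB => /eqP.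
Qed.

(** The derivative of F gg F^T = 1, where the connection is metric. *)
Lemma lcform_skew v y : U y -> so7 (om v y).
Proof.
move=> Uy.
have := frame_derive v Uy; move: (om v y) => O dF.
have dg : is_derive y v gg (G v y *m gg y + gg y *m (G v y)^T).
  by rewrite -lcmx_metric //; apply: diff_is_derive; exact: smooth_diff Uy.
have := is_derive_mulmx (is_derive_mulmx dF dg) (is_derive_trmx dF).
have n1 : \forall z \near y, F z *m gg z *m (F z)^T = 1%:M.
  by apply: filterS (open_nbhs_nbhs (conj oU Uy)) => z; exact: Fon.
move=> /(near_eq_is_derive n1) /deriveP; rewrite derive_cst => /esym h.
apply/eqP; rewrite -addr_eq0 addrC -{}h.
rewrite raddfB /= !trmx_mul mulmxBl mulmxDr !mulmxDl !mulmxBr !mulNmx.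
rewrite -2!(mulmxA O) (mulmxA (F y)) Fon // mulmx1.
rewrite [F y *m gg y *m ((F y)^T *m _)]mulmxA Fon // mul1mx !mulmxA.
by apply/eqP; mxabel.
Qed.

(** For w constant in the chart, the frame components of the vector field S(w).
    The last term is there because w need not be parallel. *)
Lemma vector_derive (S : V -> 'M[R]_7) v w y : smooth U S -> U y ->
  is_derive y v (fun z => w *m S z *m Finv z)
   (w *m nabla_endo gg S v y *m Finv y - w *m S y *m Finv y *m om v y
    + w *m G v y *m S y *m Finv y).
Proof.
move=> sS Uy; have dS := diff_is_derive v (smooth_diff sS Uy).
have dw : is_derive y v (fun=> w) (0 : 'rV[R]_7) by exact: is_derive_cst.
have := is_derive_mulmx (is_derive_mulmx dw dS) (coframe_derive v Uy).
move=> /is_derive_eq; apply.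
rewrite mul0mx add0r /nabla_endo !(mulmxDl, mulmxDr, mulmxBl, mulmxBr, mulNmx, mulmxN) !mulmxA.
by mxabel.
Qed.

Definition curv_form v w y : 'M[R]_7 :=
  'D_v (om w) y - 'D_w (om v) y + om w y *m om v y - om v y *m om w y.

Definition curv_tensor v w y : 'M[R]_7 :=
  'D_v (G w) y - 'D_w (G v) y + G w y *m G v y - G v y *m G w y.

(** The derivative of the structure equation om F = D F + F G; the second
    derivatives of F cancel by symmetry. *)
Lemma curv_form_frame v w y : U y ->
  curv_form v w y *m F y = F y *m curv_tensor v w y.
Proof.
move=> Uy.
have E u t : 'D_u (om t) y *m F y + om t y *m (om u y *m F y - F y *m G u y)
    = 'D_u ('D_t F) y + ((om u y *m F y - F y *m G u y) *m G t y + F y *m 'D_u (G t) y).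
  have dO := diff_is_derive u (smooth_diff (smooth_lcform t) Uy).
  have dG := diff_is_derive u (smooth_diff (smooth_lcmx t) Uy).
  have dF := frame_derive u Uy.
  have dDF := diff_is_derive u (smooth_diff (smooth_derive t sF) Uy).
  have := is_derive_mulmx dO dF; have := is_deriveD dDF (is_derive_mulmx dF dG).
  move=> h1 h2; rewrite -(deriveP h1) -(deriveP h2); apply: near_eq_derive.
  by apply: filterS (open_nbhs_nbhs (conj oU Uy)) => z; exact: lcform_frame.
have E1 := E v w; have := E w v; rewrite (schwarz v w oU sF Uy).
move: E1; rewrite /curv_form /curv_tensor; mxexpand; mxgen.
move=> /matrixP h1 /matrixP h2; apply/matrixP => i j; move: (h1 i j) (h2 i j).
by rewrite !mxE; lra.
Qed.

Lemma torsion_free_derive u v w y : U y ->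
  w *m 'D_u (G v) y = v *m 'D_u (G w) y.
Proof.
move=> Uy.
have E (t t' : V) : is_derive y u (fun z => t *m G t' z) (t *m 'D_u (G t') y).
  have dG := diff_is_derive u (smooth_diff (smooth_lcmx t') Uy).
  have dt : is_derive y u (fun=> t) (0 : 'rV[R]_7) by exact: is_derive_cst.
  by have := is_derive_mulmx dt dG; rewrite mul0mx add0r.
rewrite -(deriveP (E w v)) -(deriveP (E v w)); apply: near_eq_derive.
by apply: filterS (open_nbhs_nbhs (conj oU Uy)) => z; exact: lcmx_torsion_free.
Qed.

(** Torsion-freeness and its derivative cancel the terms in pairs. *)
Lemma first_bianchi u v w y : U y ->
  u *m curv_tensor v w y + v *m curv_tensor w u y + w *m curv_tensor u v y = 0.
Proof.
move=> Uy; rewrite /curv_tensor; mxexpand.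
rewrite (torsion_free_derive v w u Uy) (torsion_free_derive w u v Uy).
rewrite (torsion_free_derive u v w Uy).
rewrite (lcmx_torsion_free w u Uy) (lcmx_torsion_free u v Uy) (lcmx_torsion_free v w Uy).
by mxabel.
Qed.

Lemma curv_form_skew v w y : U y -> so7 (curv_form v w y).
Proof.
move=> Uy.
have dS u t : so7 ('D_u (om t) y).
  have h := is_derive_trmx (diff_is_derive u (smooth_diff (smooth_lcform t) Uy)).
  have h' := is_derive_linmx (GRing.opp : {linear 'M[R]_7 -> 'M[R]_7})
    (diff_is_derive u (smooth_diff (smooth_lcform t) Uy)).
  rewrite /so7 -(deriveP h) -[RHS](deriveP h'); apply: near_eq_derive.
  by apply: filterS (open_nbhs_nbhs (conj oU Uy)) => z; exact: lcform_skew.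
have skew u : (om u y)^T = - om u y := lcform_skew u Uy.
rewrite /so7 /curv_form !raddfB !raddfD /= !trmx_mul !skew !raddfN /= !dS.
by mxexpand; mxabel.
Qed.

Lemma curv_form_anti v w y : curv_form w v y = - curv_form v w y.
Proof. by rewrite /curv_form; mxabel. Qed.

Lemma curv_form_bianchi i j k l y : U y ->
  let Om i j := curv_form (row i (F y)) (row j (F y)) y in
  Om i j k l + Om j k i l + Om k i j l = 0.
Proof.
move=> Uy /=.
have e a b m : row m (curv_form a b y) = row m (F y) *m curv_tensor a b y *m Finv y.
  by rewrite -!row_mul -curv_form_frame // -(mulmxA (curv_form a b y)) FFinv // mulmx1.
have e' a b m : curv_form a b y m l = row m (curv_form a b y) 0 l by rewrite [RHS]mxE.
rewrite !e' !e; set a := row i _; set b := row j _; set d := row k _.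
have := first_bianchi d a b Uy => /(congr1 (fun x : 'rV[R]_7 => (x *m Finv y) 0 l)).
by rewrite !mulmxDl mul0mx; mxgen; rewrite !mxE.
Qed.

End LocalGeometry.

(** * Derivatives of spinors and of their 3-forms *)

Section SpinorCalculus.
Variables (R : realType) (c : 'I_7 -> 'M[R]_8).
Hypothesis hc : clifford_module c.
Notation V := ('rV[R]_7).

(** The derivative of [crossmx s x] as s moves in the direction Y . s *)
Definition cross_var (s : 'cV[R]_8) (x Y : V) : 'M[R]_7 :=
  \matrix_(j, k) (dot (cl c Y *m s) (cl c x *m (c j *m (c k *m s)))
    + dot s (cl c x *m (c j *m (c k *m (cl c Y *m s))))).

(** Moving Y to the other factor turns the summands into - |Y|^2 <c_j s, c_k s>
    and <c_j Y s, c_k Y s>. They cancel, as the c_j map every spinor to orthogonal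
    spinors of its length. This removes the terms quadratic in S from the
    derivative of the torsion. *)
Lemma cross_var_diag s Y : cross_var s Y Y = 0.
Proof.
have cjk (t : 'cV[R]_8) j k : dot t (c j *m (c k *m t)) = - (j == k)%:R * dot t t.
  rewrite dotMr (cliff_tr hc) mulNmx dotNl -!cl_delta (dot_clcl hc) mulNr.
  congr (- (_ * _)); rewrite row_dot (bigD1 j) //= big1 => [|l lj]; last first.
    by rewrite !mxE (negbTE lj) andbF mul0r.
  by rewrite !mxE !eqxx /= mul1r addr0 eq_sym.
apply/matrixP => j k; rewrite !mxE.
rewrite dotMr (cl_tr hc) mulmxA mulNmx (cl_sq hc) raddfN /= opprK mul_scalar_mx dotZl cjk.
rewrite (dotMr (cl c Y) s) (cl_tr hc) mulNmx dotNl cjk (dot_clcl hc).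
by ring.
Qed.

Lemma cl_row (O : 'M[R]_7) j : cl c (delta_mx 0 j *m O) = \sum_l O j l *: c l.
Proof. by rewrite -rowE /cl; apply: eq_bigr => l _; rewrite mxE. Qed.

(** The 3-form is equivariant under Spin(7): the part - O of the motion of phi
    rotates the indices j, k and the argument X, and only the direction Y . phi
    changes the 3-form itself. *)
Lemma cross_derive (phi : V -> 'cV[R]_8) (X : V -> 'rV[R]_7) y v Y dX (O : 'M[R]_7) :
  so7 O ->
  is_derive y v phi (cl c Y *m phi y - spin_lift c O *m phi y) ->
  is_derive y v X dX ->
  is_derive y v (fun z => crossmx c (phi z) (X z))
   (crossmx c (phi y) (dX + X y *m O) + cross_var (phi y) (X y) Y
    + O *m crossmx c (phi y) (X y) - crossmx c (phi y) (X y) *m O).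
Proof.
move=> hO hphi hX; apply/is_derive_mxP => j k.
pose f z := (phi z)^T *m cl c (X z) *m c j *m c k *m phi z.
have -> : (fun z => crossmx c (phi z) (X z) j k) = (fun z => f z 0 0).
  by apply/funext => z; rewrite mxE.
have dcst (B : 'M[R]_8) : is_derive y v (fun=> B) (0 : 'M[R]_8) by exact: is_derive_cst.
have dclX := is_derive_linmx (cl c) hX.
have := is_derive_mulmx (is_derive_mulmx (is_derive_mulmx
  (is_derive_mulmx (is_derive_trmx hphi) dclX) (dcst (c j))) (dcst (c k))) hphi.
move=> /is_derive_mxP /(_ 0 0) /is_derive_eq; apply.
rewrite !mulmx0 !addr0.
move: (phi y) (X y) => s x; pose L := spin_lift c O.
have sL : L^T = - L by exact: lift_skew.
have cj i : L *m c i = c i *m L + \sum_l O i l *: c l.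
  by rewrite -cl_row -!cl_delta (lift_cl_eq hc).
pose T := crossmx c s x.
have TE : dot s (L *m (cl c x *m (c j *m (c k *m s))))
    = dot s (cl c x *m (c j *m (c k *m (L *m s)))) + crossmx c s (x *m O) j k
    + (O *m T) j k - (T *m O) j k.
  rewrite [L *m _]mulmxA (lift_cl_eq hc) // mulmxDl dotDr (crossE c s (x *m O)).
  rewrite -[cl c x *m L *m _]mulmxA [L *m _]mulmxA cj mulmxDl mulmxDr dotDr.
  rewrite -[c j *m L *m _]mulmxA [L *m _]mulmxA cj mulmxDl !mulmxDr dotDr !mulmxA.
  have -> : (O *m T) j k = dot s (cl c x *m (\sum_l O j l *: c l) *m c k *m s).
    rewrite mxE mulmx_sumr 2!mulmx_suml dot_sumr; apply: eq_bigr => l _.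
    by rewrite -(scalemxAr (O j l)) -2!scalemxAl dotZr crossE !mulmxA.
  have -> : (T *m O) j k = - dot s (cl c x *m c j *m (\sum_l O k l *: c l) *m s).
    rewrite mxE mulmx_sumr mulmx_suml dot_sumr -sumrN; apply: eq_bigr => l _.
    by rewrite -(scalemxAr (O k l)) -scalemxAl dotZr crossE (so7E hO k l) !mulmxA; ring.
  by ring.
pose d := cl c Y *m s - L *m s.
transitivity (dot d (cl c x *m (c j *m (c k *m s)))
   + dot s (cl c dX *m (c j *m (c k *m s)))
   + dot s (cl c x *m (c j *m (c k *m d)))).
  by rewrite /dot !mulmxDl !mulmxA [LHS]mxE [X in X + _]mxE.
have addE (A1 A2 A3 A4 A5 : 'M[R]_7) :
    (A1 + A2 + A3 + A4 - A5) j k = A1 j k + A2 j k + A3 j k + A4 j k - A5 j k.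
  by rewrite !mxE.
rewrite (linearD (crossmx c s)) addE -/T [cross_var _ _ _ _ _]mxE (crossE c s dX) /d.
have eL : dot (L *m s) (cl c x *m (c j *m (c k *m s)))
    = - dot s (L *m (cl c x *m (c j *m (c k *m s)))).
  by rewrite [in RHS]dotMr sL mulNmx dotNl opprK.
rewrite dotC dotBr dotC [dot _ (L *m s)]dotC eL TE !mulmxBr dotBr.
by ring.
Qed.

(** The passage from chart components to frame components of a covariant
    derivative, freed from the analysis: I is the inverse of the frame Fm, O the
    connection form, Gm the Christoffel matrix, T an endomorphism in the frame. *)
Lemma frame_conjugation (a : R) (Fm I O Gm T dT T' : 'M[R]_7) :
  Fm *m I = 1%:M ->
  Fm *m ((a *: ((Gm *m I - I *m O) *m T *m Fm + I *m dT *m Fm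
      + I *m T *m (O *m Fm - Fm *m Gm))
    + a *: (I *m T *m Fm) *m Gm - a *: (I *m T' *m Fm)
    - Gm *m (a *: (I *m T *m Fm)))) *m I
  = a *: (dT - O *m T + T *m O - T').
Proof.
move=> FI; rewrite -scalemxAl -scalemxAr -scalerDr -2!scalerBr -scalemxAr -scalemxAl.
congr (_ *: _).
have -> : (Gm *m I - I *m O) *m T *m Fm + I *m dT *m Fm + I *m T *m (O *m Fm - Fm *m Gm)
    + I *m T *m Fm *m Gm - I *m T' *m Fm - Gm *m (I *m T *m Fm)
    = I *m (dT - O *m T + T *m O - T') *m Fm.
  by mxexpand; mxabel.
by rewrite !mulmxA FI mul1mx -mulmxA FI mulmx1.
Qed.

Section MovingFrame.
Variables (U : set V) (gg F S : V -> 'M[R]_7) (phi : V -> 'cV[R]_8).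
Hypotheses (oU : open U) (sg : smooth U gg) (sF : smooth U F).
Hypotheses (sS : smooth U S) (sphi : smooth U phi).
Hypothesis gsym : forall y, U y -> (gg y)^T = gg y.
Hypothesis Fon : forall y, U y -> F y *m gg y *m (F y)^T = 1%:M.
Hypothesis phi1 : forall y, U y -> unit_spinor (phi y).
Notation G := (lcmx gg).
Notation om := (lcform gg F).
Notation I := (coframe gg F).
Notation nab := (nabla_endo gg S).
Hypothesis spin_eq : forall v y, U y ->
  'D_v phi y + spin_lift c (om v y) *m phi y = cl c (v *m S y *m I y) *m phi y.
Implicit Types v w y : V.

Lemma spinor_derive v y : U y ->
  is_derive y v phi (cl c (v *m S y *m I y) *m phi y - spin_lift c (om v y) *m phi y).
Proof.
move=> Uy; rewrite -spin_eq // addrK; apply: diff_is_derive; exact: smooth_diff Uy.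
Qed.

(** The endomorphism that [torsion_formula] identifies with xi_w, in chart
    components. *)
Definition torsion_field w y : 'M[R]_7 :=
  (2 / 3) *: (I y *m crossmx c (phi y) (w *m S y *m I y) *m F y).

(** The derivative of phi in the direction S(v) . phi enters through [cross_var]
    at S(v), contracted with S(v) itself, and vanishes by [cross_var_diag]. *)
Lemma torsion_cov_der v y : U y ->
  F y *m ('D_v (torsion_field v) y + torsion_field v y *m G v y
     - torsion_field (v *m G v y) y - G v y *m torsion_field v y) *m I y
  = (2 / 3) *: crossmx c (phi y) (v *m nab v y *m I y).
Proof.
move=> Uy.
have hO := lcform_skew oU sg sF gsym Fon v Uy.
have dX := vector_derive oU sg sF Fon v v sS Uy.
have dT := cross_derive hO (spinor_derive v Uy) dX.
have dI := coframe_derive oU sg sF Fon v Uy.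
have dF := frame_derive sF Fon v Uy.
have h := is_deriveZ (2 / 3) (is_derive_mulmx (is_derive_mulmx dI dT) dF).
have -> : 'D_v (torsion_field v) y = _ := deriveP h.
rewrite /torsion_field.
rewrite cross_var_diag // addr0.
set T := crossmx c (phi y) (v *m S y *m I y).
set O := om v y; set Gm := G v y; set Im := I y; set Fm := F y.
set dTm := _ - T *m O.
have := @frame_conjugation (2 / 3) Fm Im O Gm T dTm
   (crossmx c (phi y) (v *m Gm *m S y *m Im)) (FFinv Fon Uy).
rewrite [(_ *m T + _ *m dTm) *m Fm]mulmxDl => ->; congr (_ *: _).
have -> : dTm - O *m T + T *m O = crossmx c (phi y)
    (v *m nab v y *m Im - v *m S y *m Im *m O + v *m Gm *m S y *m Im + v *m S y *m Im *m O).
  by rewrite /dTm [X in X + _]addrAC addrK subrK.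
rewrite -linearB; congr (crossmx _ _ _).
by rewrite /Im /Gm /O; mxabel.
Qed.

(** The antisymmetrized second derivative of phi, computed from the spinor
    equation; the lift of the curvature form collects the commutators of the
    connection forms. *)
Lemma spinor_curvature v w y : U y ->
  spin_lift c (curv_form gg F v w y) *m phi y
  = cl c ((w *m nab v y - v *m nab w y) *m I y) *m phi y
    + (cl c (w *m S y *m I y) *m cl c (v *m S y *m I y)
       - cl c (v *m S y *m I y) *m cl c (w *m S y *m I y)) *m phi y.
Proof.
move=> Uy.
have skew u := lcform_skew oU sg sF gsym Fon u Uy.
have E u t : 'D_u ('D_t phi) y
    = cl c (t *m nab u y *m I y - t *m S y *m I y *m om u y + t *m G u y *m S y *m I y) *m phi y
      + cl c (t *m S y *m I y) *m (cl c (u *m S y *m I y) *m phi y - spin_lift c (om u y) *m phi y)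
      - (spin_lift c ('D_u (om t) y) *m phi y
         + spin_lift c (om t y) *m (cl c (u *m S y *m I y) *m phi y - spin_lift c (om u y) *m phi y)).
  have dX := is_derive_linmx (cl c) (vector_derive oU sg sF Fon u t sS Uy).
  have dO := is_derive_linmx (spin_lift c)
    (diff_is_derive u (smooth_diff (smooth_lcform oU sg sF Fon t) Uy)).
  have dp := spinor_derive u Uy.
  have h := is_deriveB (is_derive_mulmx dX dp) (is_derive_mulmx dO dp).
  rewrite -(deriveP h); apply: near_eq_derive.
  apply: filterS (open_nbhs_nbhs (conj oU Uy)) => z Uz.
  by have := spin_eq t Uz => /(canRL (addrK _)).
have := E v w; rewrite (schwarz w v oU sphi Uy) (E w v).
rewrite /curv_form (lcmx_torsion_free oU sg gsym v w Uy).
have -> : spin_lift c ('D_v (om w) y - 'D_w (om v) y + om w y *m om v y - om v y *m om w y)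
  = spin_lift c ('D_v (om w) y) - spin_lift c ('D_w (om v) y)
    + (spin_lift c (om v y) *m spin_lift c (om w y) - spin_lift c (om w y) *m spin_lift c (om v y)).
  by rewrite lift_bracket // -linearB -linearD addrA.
move: ('D_v (om w) y) ('D_w (om v) y) (skew v) (skew w) => A B.
move: (om v y) (om w y) => Ov Ow sv sw.
rewrite [(w *m nab v y - v *m nab w y) *m I y]mulmxBl.
rewrite !(linearD (cl c)) !(linearN (cl c)) /=.
rewrite -(lift_cl hc (v *m S y *m I y) sw) -(lift_cl hc (w *m S y *m I y) sv).
move: (phi y) (spin_lift c A) (spin_lift c B) (spin_lift c Ov) (spin_lift c Ow).
move: (cl c (v *m S y *m I y)) (cl c (w *m S y *m I y)) (cl c (v *m G w y *m S y *m I y)).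
move: (cl c (v *m nab w y *m I y)) (cl c (w *m nab v y *m I y)).
move=> nw nv k s_v s_w p a b l_v l_w; mxexpand; mxgen.
move=> /matrixP h; apply/matrixP => i j; move: (h i j).
by rewrite !mxE; lra.
Qed.

Section Traceless.
Hypothesis symS : forall y, U y -> S y *m gg y = gg y *m (S y)^T.
Hypothesis trS : forall y, U y -> \tr (S y) = 0.

(** In an orthonormal frame S is a field of symmetric traceless matrices, and its
    covariant derivative differs from the plain one by a commutator with a skew
    matrix, which is again symmetric and traceless. *)
Lemma nabla_endo_sym_traceless v y : U y ->
  (F y *m nab v y *m I y)^T = F y *m nab v y *m I y
  /\ \tr (F y *m nab v y *m I y) = 0.
Proof.
move=> Uy; pose Sh z := F z *m S z *m I z.
have hO := lcform_skew oU sg sF gsym Fon v Uy.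
have dF := frame_derive sF Fon v Uy.
have dS := diff_is_derive v (smooth_diff sS Uy).
have dI := coframe_derive oU sg sF Fon v Uy.
have dSh : is_derive y v Sh
    (F y *m nab v y *m I y + om v y *m Sh y - Sh y *m om v y).
  have := is_derive_mulmx (is_derive_mulmx dF dS) dI.
  move=> /is_derive_eq; apply; rewrite /Sh /nabla_endo.
  move: (om v y) => O; mxexpand; by mxabel.
have nShT : \forall z \near y, (Sh z)^T = Sh z.
  apply: filterS (open_nbhs_nbhs (conj oU Uy)) => z Uz.
  rewrite /Sh coframe.unlock !trmx_mul trmxK gsym // -!mulmxA; congr (_ *m _).
  by rewrite !mulmxA -symS.
have eT := deriveP (near_eq_is_derive nShT (is_derive_trmx dSh)).
have {eT} eT := etrans (esym eT) (deriveP dSh).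
have ShT : (Sh y)^T = Sh y by exact: nbhs_singleton nShT.
split.
  move: eT ShT hO; move: (Sh y) (om v y) (F y *m nab v y *m I y) => A O N eT AT OT.
  move: eT; rewrite raddfB raddfD /= !trmx_mul AT OT mulmxN mulNmx.
  move: (O *m A) (A *m O) N^T => P Q NT.
  by move=> /matrixP h; apply/matrixP => i j; move: (h i j); rewrite !mxE; lra.
rewrite -mulmxA mxtrace_mulC -mulmxA (FinvF Fon Uy) mulmx1.
rewrite /nabla_endo raddfB raddfD /= [\tr (S y *m _)]mxtrace_mulC addrK.
have -> : \tr ('D_v S y) = 'D_v (fun z => \tr (S z) : R^o) y.
  have : is_derive y v (\sum_i (fun z => S z i i : R^o)) (\sum_i 'D_v S y i i).
    by apply: is_derive_sum => i; have /is_derive_mxP := dS; apply.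
  move=> /deriveP h; transitivity (\sum_i 'D_v S y i i); first by [].
  rewrite -h; congr ('D_v _ y).
  by apply/funext => z; rewrite fct_sumE.
have n0 : \forall z \near y, \tr (S z) = 0.
  by apply: filterS (open_nbhs_nbhs (conj oU Uy)) => z; exact: trS.
by rewrite (near_eq_derive v n0) derive_cst.
Qed.

(** Contracting [spinor_curvature] with c_i c_j makes 2 (div S) . phi a multiple
    b - b' of phi. It is also orthogonal to phi. *)
Lemma traceless_divergence y : U y ->
  \sum_i row i (F y) *m nab (row i (F y)) y = 0.
Proof.
move=> Uy; pose f i := row i (F y).
pose N i := F y *m nab (f i) y *m I y; pose Sh := F y *m S y *m I y.
have hN i := (nabla_endo_sym_traceless (f i) Uy).1.
have tN i := (nabla_endo_sym_traceless (f i) Uy).2.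
have hSh : Sh^T = Sh.
  rewrite /Sh coframe.unlock !trmx_mul trmxK gsym // -!mulmxA; congr (_ *m _).
  by rewrite !mulmxA -symS.
have tSh : \tr Sh = 0 by rewrite /Sh -mulmxA mxtrace_mulC -mulmxA (FinvF Fon Uy) mulmx1 trS.
have [b' hb'] := dirac_contraction hc hN tN hSh tSh.
pose Om i j := curv_form gg F (f i) (f j) y.
have [b hb] := lichnerowicz_scalar hc (fun i j => curv_form_skew oU sg sF gsym Fon (f i) (f j) Uy)
  (fun i j => curv_form_anti gg F (f i) (f j) y)
  (fun i j k l => curv_form_bianchi oU sg sF gsym Fon i j k l Uy).
have rN i j : row j (N i) = f j *m nab (f i) y *m I y by rewrite !row_mul.
have rS j : row j Sh = f j *m S y *m I y by rewrite !row_mul.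
have E : b%:M *m phi y = (cl c (\sum_i row i (N i)) *+ 2 + b'%:M) *m phi y.
  rewrite -hb -hb' !mulmx_suml; apply: eq_bigr => i _.
  rewrite !mulmx_suml; apply: eq_bigr => j _.
  rewrite -(mulmxA (c i *m c j)) (spinor_curvature (f i) (f j) Uy).
  rewrite -(mulmxA (c i *m c j)) [RHS]mulmxA; apply: esym.
  rewrite -mulmxDl mulmxA; congr (_ *m (_ + _) *m _).
    by rewrite !row_mul mulmxBl.
  by rewrite !rS.
have {}E : (cl c (\sum_i row i (N i)) *m phi y) *+ 2 = (b - b') *: phi y.
  move: E; rewrite mulmxDl !mul_scalar_mx mulr2n mulmxDl -mulr2n => E.
  by rewrite scalerBl E addrK.
have u1 := unit_dot (phi1 Uy).
have bb : b - b' = 0.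
  have := congr1 (dot (phi y)) E.
  by rewrite mulr2n dotDr dot_cl // addr0 dotZr u1 mulr1 => /esym.
have : cl c (\sum_i row i (N i)) *m phi y = 0.
  by apply: (mulS_inj (n := 1)); rewrite E bb scale0r mul0rn.
move=> /(cl_inj hc (phi1 Uy)) h0.
have -> : \sum_i row i (F y) *m nab (row i (F y)) y = (\sum_i row i (N i)) *m F y.
  rewrite mulmx_suml; apply: eq_bigr => i _.
  by rewrite rN -(mulmxA _ (I y)) (FinvF Fon Uy) mulmx1.
by rewrite h0 mul0mx.
Qed.

End Traceless.
End MovingFrame.
End SpinorCalculus.

(** * Transport of unit spinors by Spin(7) *)

Section SpinTransport.
Variables (R : realType) (c : 'I_7 -> 'M[R]_8).
Hypothesis hc : clifford_module c.

(** Both sides are the determinant of the matrix with blocks 1, A, B, 1. *)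
Lemma det_1subM m n (A : 'M[R]_(m, n)) (B : 'M[R]_(n, m)) :
  \det (1%:M - A *m B) = \det (1%:M - B *m A).
Proof.
have e1 : block_mx 1%:M A B 1%:M
    = block_mx (1%:M - A *m B) A 0 1%:M *m block_mx 1%:M 0 B 1%:M.
  rewrite mulmx_block !mul0mx !mulmx1 !mul1mx !mulmx0 !add0r.
  by rewrite subrK.
have e2 : block_mx 1%:M A B 1%:M
    = block_mx 1%:M 0 B 1%:M *m block_mx 1%:M A 0 (1%:M - B *m A).
  rewrite mulmx_block !(mul0mx, mulmx1, mul1mx, mulmx0, addr0).
  by rewrite addrC subrK.
have := congr1 determinant (etrans (esym e1) e2); rewrite !det_mulmx !det_lblock !det_ublock !det1 !mulr1 !mul1r.
by [].
Qed.

(** The reflection in the hyperplane normal to x, where n = |x|^2. *)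
Definition reflection (n : R) (x : 'rV[R]_7) : 'M[R]_7 :=
  1%:M - (2 / n) *: (x^T *m x).

Section Reflection.
Variables (n : R) (x : 'rV[R]_7).
Hypotheses (n0 : n != 0) (xn : x *m x^T = n%:M).

Lemma reflection_orth : reflection n x *m (reflection n x)^T = 1%:M.
Proof.
have sR : (reflection n x)^T = reflection n x.
  by rewrite /reflection raddfB /= trmxZ trmx_mul trmxK trmx1.
rewrite sR /reflection mulmxBr mulmx1 mulmxBl mul1mx -scalemxAl -scalemxAr.
have -> : x^T *m x *m (x^T *m x) = n *: (x^T *m x).
  by rewrite mulmxA -(mulmxA x^T) xn mul_mx_scalar -scalemxAl.
rewrite !scalerA; apply/matrixP => i j; rewrite !mxE.
by field.
Qed.

Lemma reflection_det : \det (reflection n x) = -1.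
Proof.
rewrite /reflection scalemxAl det_1subM -scalemxAr xn scale_scalar_mx divfK //.
by rewrite -raddfB /= det_scalar1; ring.
Qed.

Lemma reflection_cl v :
  cl c x *m cl c v = - (cl c (v *m reflection n x) *m cl c x).
Proof.
rewrite (clC hc) /reflection mulmxBr mulmx1 -scalemxAr (linearB (cl c)) /= mulmxBl opprB.
have -> : v *m (x^T *m x) = (v *m x^T) 0 0 *: x.
  by rewrite mulmxA {1}[v *m x^T]mx11_scalar mul_scalar_mx.
rewrite scalerA linearZ /= -scalemxAl (cl_sq hc) xn [n%:M _ _]mxE eqxx mulr1n scale_scalar_mx.
rewrite addrC; congr (_ + _); rewrite -raddfN /=; congr _%:M.
by rewrite -mulr_natl; field.
Qed.

End Reflection.

(** If chi is orthogonal to a unit spinor omega, then chi = z . omega for this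
    vector z. *)
Definition spin_z (omega chi : 'cV[R]_8) : 'rV[R]_7 := \row_i dot (c i *m omega) chi.
Definition spin_y (s chi : 'cV[R]_8) : 'rV[R]_7 := - spin_z s chi.

Lemma spin_zP omega chi : unit_spinor omega -> dot omega chi = 0 ->
  cl c (spin_z omega chi) *m omega = chi.
Proof.
move=> ho h; rewrite [RHS](spinor_expand hc chi ho) h scale0r add0r /cl mulmx_suml.
by apply: eq_bigr => i _; rewrite mxE -scalemxAl.
Qed.

Lemma spin_z_norm omega chi : unit_spinor omega -> dot omega chi = 0 ->
  spin_z omega chi *m (spin_z omega chi)^T = (dot chi chi)%:M.
Proof.
move=> ho h; rewrite [LHS]mx11_scalar; congr _%:M.
by rewrite -[LHS]mulr1 -(unit_dot ho) -(dot_clcl hc) spin_zP.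
Qed.

(** If chi is a common normal of omega and s, then z . omega = chi and
    y . chi = |chi|^2 s, so this element carries omega to s. It is rational in s and
    chi. *)
Definition transport_spin (omega s chi : 'cV[R]_8) : 'M[R]_8 :=
  (dot chi chi)^-1 *: (cl c (spin_y s chi) *m cl c (spin_z omega chi)).

Definition transport_rot (omega s chi : 'cV[R]_8) : 'M[R]_7 :=
  reflection (dot chi chi) (spin_z omega chi)
  *m reflection (dot chi chi) (spin_y s chi).

Section Transport.
Variables omega s chi : 'cV[R]_8.
Hypotheses (ho : unit_spinor omega) (hs : unit_spinor s).
Hypotheses (oc : dot omega chi = 0) (sc : dot s chi = 0) (c0 : dot chi chi != 0).

Let zn : spin_z omega chi *m (spin_z omega chi)^T = (dot chi chi)%:M.
Proof. exact: spin_z_norm. Qed.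

Let yn : spin_y s chi *m (spin_y s chi)^T = (dot chi chi)%:M.
Proof. by rewrite /spin_y raddfN /= mulmxN mulNmx opprK spin_z_norm. Qed.

Lemma transport_covers :
  covers c (transport_spin omega s chi) (transport_rot omega s chi).
Proof.
move=> v; rewrite /transport_spin -scalemxAl -scalemxAr; congr (_ *: _).
rewrite -mulmxA (reflection_cl c0 zn) mulmxN mulmxA.
by rewrite (reflection_cl c0 yn (v *m _)) mulNmx opprK /transport_rot !mulmxA.
Qed.

Lemma transport_rot_orth :
  transport_rot omega s chi *m (transport_rot omega s chi)^T = 1%:M.
Proof.
rewrite /transport_rot trmx_mul mulmxA -(mulmxA (reflection _ _)).
by rewrite (reflection_orth c0 yn) mulmx1 (reflection_orth c0 zn).
Qed.

Lemma transport_rot_det : \det (transport_rot omega s chi) = 1.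
Proof.
by rewrite det_mulmx (reflection_det c0 zn) (reflection_det c0 yn) mulrNN mulr1.
Qed.

Lemma transport_spinE : transport_spin omega s chi *m omega = s.
Proof.
rewrite /transport_spin -scalemxAl -mulmxA spin_zP //.
have ys : cl c (spin_y s chi) *m s = - chi by rewrite linearN mulNmx /= spin_zP.
have := congr1 (mulmx (cl c (spin_y s chi))) ys.
rewrite mulmxA (cl_sq hc) yn mxE eqxx mulr1n mul_scalar_mx scaleNr mulmxN => /oppr_inj <-.
by rewrite scalerA mulVf // scale1r.
Qed.

(** Both vectors have the length of chi, so they can be normalized together. *)
Lemma transport_spin_group u :
  spin_group c u -> spin_group c (transport_spin omega s chi *m u).
Proof.
move=> hu; pose r := (Num.sqrt (dot chi chi))^-1.
have cp : 0 < dot chi chi by rewrite lt_def c0 dot_ge0.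
have rr : r * r = (dot chi chi)^-1 by rewrite -expr2 exprVn sqr_sqrtr // ltW.
have nr (x : 'rV[R]_7) : x *m x^T = (dot chi chi)%:M -> (r *: x) *m (r *: x)^T = 1%:M.
  move=> hx; rewrite trmxZ -scalemxAl -scalemxAr scalerA rr hx scale_scalar_mx mulVf //.
have := spin_mul (nr _ yn) (nr _ zn) hu.
suff -> : cl c (r *: spin_y s chi) *m cl c (r *: spin_z omega chi)
  = transport_spin omega s chi by [].
have rcl x : cl c (r *: x) = r *: cl c x by rewrite linearZ.
by rewrite (rcl (spin_y _ _)) (rcl (spin_z _ _)) -scalemxAl -scalemxAr scalerA rr.
Qed.

End Transport.

(** Two spinors have a common normal, the dimension being greater than two. *)
Lemma spin_transitive (s t : 'cV[R]_8) : unit_spinor s -> unit_spinor t ->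
  exists u Q, [/\ spin_group c u, covers c u Q, Q *m Q^T = 1%:M, \det Q = 1
    & u *m s = t].
Proof.
move=> hs ht.
pose A : 'M[R]_(8, 1 + 1) := row_mx s t.
have [chi chi0 hA] : exists2 chi : 'cV[R]_8, chi != 0 & A^T *m chi = 0.
  have : kermx A != 0.
    rewrite -mxrank_eq0 mxrank_ker subn_eq0 -ltnNge.
    exact: leq_ltn_trans (rank_leq_col A) _.
  move=> /rowV0Pn [v /sub_kermxP vA v0]; exists v^T.
    by apply: contra_neq v0 => /(congr1 trmx); rewrite trmxK trmx0.
  by rewrite -trmx_mul vA trmx0.
have [sc tc] : dot s chi = 0 /\ dot t chi = 0.
  move: hA; rewrite /A tr_row_mx mul_col_mx => /eqP.
  rewrite col_mx_eq0 => /andP[/eqP h1 /eqP h2].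
  by rewrite /dot h1 h2 mxE.
have c0 : dot chi chi != 0 by apply: contra_neq chi0; exact: dot_eq0.
exists (transport_spin s t chi), (transport_rot s t chi); split.
- by rewrite -[transport_spin _ _ _]mulmx1; apply: transport_spin_group => //; exact: spin_one.
- exact: transport_covers.
- exact: transport_rot_orth.
- exact: transport_rot_det.
- exact: transport_spinE.
Qed.

(** With f the component of s normal to omega, this is |f|^2 times the component
    of eta normal to f: a common normal of omega and s that is polynomial in s. *)
Definition normal_spinor (omega eta s : 'cV[R]_8) : 'cV[R]_8 :=
  let f := s - dot s omega *: omega in dot f f *: eta - dot eta f *: f.

Lemma normal_spinorP omega eta s : unit_spinor omega -> dot omega eta = 0 ->
  dot omega (normal_spinor omega eta s) = 0 /\ dot s (normal_spinor omega eta s) = 0.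
Proof.
move=> ho he; rewrite /normal_spinor; set f := s - _.
have of0 : dot omega f = 0 by rewrite dotBr dotZr (unit_dot ho) mulr1 dotC subrr.
have h1 : dot omega (dot f f *: eta - dot eta f *: f) = 0.
  by rewrite dotBr !dotZr he of0 !mulr0 subrr.
split=> //; have -> : s = f + dot s omega *: omega by rewrite subrK.
by rewrite dotDl dotZl h1 mulr0 addr0 dotBr !dotZr (dotC f eta) mulrC subrr.
Qed.

Lemma normal_spinor_orth omega eta s :
  unit_spinor s -> dot s omega = 0 -> dot eta s = 0 ->
  normal_spinor omega eta s = eta.
Proof.
move=> hs h1 h2; rewrite /normal_spinor h1 scale0r subr0 (unit_dot hs) scale1r h2.
by rewrite scale0r subr0.
Qed.

End SpinTransport.

(** * Charts *)

Lemma smooth_sub (R : realType) (V W : normedModType R) (U U' : set V) (f : V -> W) :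
  U' `<=` U -> smooth U f -> smooth U' f.
Proof.
move=> UU /smoothP h; apply/smoothP => s x /UU; exact: h.
Qed.

Section Charts.
Variables (R : realType) (M : topologicalType) (A : atlas R M).
Hypothesis hM : oriented_manifold A.
Implicit Types (a : chart A) (W : set M) (p : M).
Notation V := ('rV[R]_7).

Definition chart_set a W : set V :=
  [set x | (local_coord a @` dom a) x /\ W (local_param a x)].

Lemma chart_setP a W p : dom a p -> W p -> chart_set a W (local_coord a p).
Proof. by move=> ap Wp; split; [exists p|rewrite (om_paramK hM)]. Qed.

Lemma chart_set_inv a W x : chart_set a W x ->
  [/\ dom a (local_param a x), W (local_param a x)
    & local_coord a (local_param a x) = x].
Proof. by move=> [[p ap <-]]; rewrite (om_paramK hM). Qed.

Lemma chart_set_open a W : open W -> open (chart_set a W).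
Proof.
move=> oW; rewrite openE => x [[p ap xp] Wx].
have nU : nbhs x (local_coord a @` dom a).
  by apply: open_nbhs_nbhs; split; [exact: (om_image_open hM)|exists p].
have nW : nbhs x (local_param a @^-1` W).
  have := om_param_cont hM ap; rewrite xp => cx; apply: cx.
  exact: open_nbhs_nbhs.
exact: filterI nU nW.
Qed.

Lemma chart_set_sub a W W' : W `<=` W' -> chart_set a W `<=` chart_set a W'.
Proof. by move=> WW x [h Wx]; split=> //; exact: WW. Qed.

Lemma mder_param (W' : normedModType R) a W (F : M -> W') v x : chart_set a W x ->
  mder a v F (local_param a x) = 'D_v (F \o local_param a) x.
Proof. by move=> /chart_set_inv [_ _]; rewrite /mder => ->. Qed.

Lemma smooth_inP (W' : normedModType R) a W (F : M -> W') : open W ->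
  smooth_in a W F <-> smooth (chart_set a W) (F \o local_param a).
Proof.
move=> oW; have oU := chart_set_open (a := a) oW.
have E (s : seq V) x : chart_set a W x ->
    foldr (fun v H => mder a v H) F s (local_param a x)
    = foldr (fun v H => 'D_v H) (F \o local_param a) s x.
  elim: s x => [|v s IH] x Ux //=; rewrite (mder_param _ _ Ux).
  by apply: near_eq_derive; apply: filterS (open_nbhs_nbhs (conj oU Ux)).
have nE s x : chart_set a W x -> {near x,
    foldr (fun v H => 'D_v H) (F \o local_param a) s
    =1 foldr (fun v H => mder a v H) F s \o local_param a}.
  by move=> Ux; apply: filterS (open_nbhs_nbhs (conj oU Ux)) => y /(E s).
split=> [h|].
  apply/smoothP => s x Ux; have [ax Wx cx] := chart_set_inv Ux.
  have := h s _ Wx ax; rewrite cx; apply: near_eq_differentiable.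
  by apply: filterS (nE s x Ux) => y ->.
move=> /smoothP h s p Wp ap; have Ux := chart_setP ap Wp.
by apply: near_eq_differentiable (h s _ Ux); exact: nE.
Qed.

Lemma smooth_on_continuous (W' : normedModType R) W (F : M -> W') p : open W ->
  smooth_on A W F -> W p -> {for p, continuous F}.
Proof.
move=> oW sF Wp; have [a ap] := om_cover hM p.
have Ux := chart_setP ap Wp.
have /(smooth_inP _ _ oW) sf := sF a.
have cf : {for local_coord a p, continuous (F \o local_param a)}.
  by apply: differentiable_continuous; exact: smooth_diff sf Ux.
have cc := om_coord_cont hM ap.
have h : F (local_param a (local_coord a q)) @[q --> p] --> F p.
  by have := continuous_comp cc cf; rewrite /prop_for /continuous_at /= (om_paramK hM).
apply: cvg_trans h; apply: near_eq_cvg.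
have : nbhs p (dom a) by apply: open_nbhs_nbhs; split=> //; exact: (om_dom_open hM).
by apply: filterS => q aq /=; rewrite (om_paramK hM).
Qed.

(** The function is constant on coordinate balls, so its level sets are open and
    closed. *)
Lemma derive0_is_constant (lam : M -> R) : smooth_on A [set: M] (lam : M -> R^o) ->
  (forall a p v, dom a p -> mder a v (lam : M -> R^o) p = 0) -> is_constant lam.
Proof.
move=> sl dl.
have loc p : \forall q \near p, lam q = lam p.
  have [a ap] := om_cover hM p.
  have oU := chart_set_open (a := a) (@openT M).
  have Ux := chart_setP (W := [set: M]) ap I.
  have /(smooth_inP _ _ openT) sf := sl a.
  have /nbhs_ballP [d /= d0 hd] := open_nbhs_nbhs (conj oU Ux).
  have cst := ball_derive0_const d0 (fun y hy => smooth_diff sf (hd y hy)).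
  have Dl y v : ball (local_coord a p) d y -> 'D_v ((lam : M -> R^o) \o local_param a) y = 0.
    move=> hy; rewrite -(mder_param _ _ (hd y hy)).
    by have [ay _ _] := chart_set_inv (hd y hy); exact: dl.
  have {}cst := cst Dl.
  have na : nbhs p (dom a) by apply: open_nbhs_nbhs; split=> //; exact: (om_dom_open hM).
  have nb : nbhs p (local_coord a @^-1` ball (local_coord a p) d).
    by apply: (om_coord_cont hM ap); exact: nbhsx_ballx.
  apply: filterS (filterI na nb) => q [aq bq].
  by have /= := cst _ bq; rewrite !(om_paramK hM).
have [[p0]|noM] := pselect (exists p : M, True); last first.
  by exists 0 => p; case: noM; exists p.
move=> _; exists (lam p0).
have oE (B : set R) : open (lam @^-1` B).
  rewrite openE => p Bp; rewrite /interior; apply: filterS (loc p) => q /= ->.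
  exact: Bp.
have BT : lam @^-1` [set lam p0] = [set: M].
  apply: (om_connected hM); first by exists p0.
  - by exists (lam @^-1` [set lam p0]); [exact: oE|rewrite setTI].
  - exists (lam @^-1` [set lam p0]); last by rewrite setTI.
    by rewrite -openC preimage_setC; exact: oE.
by move=> p; have : [set: M] p by []; rewrite -BT.
Qed.

End Charts.

(** * Local sections of the G_2-reduction *)

Section AdaptedFrames.
Variables (R : realType) (M : topologicalType) (A : atlas R M).
Variables (g : mfield A) (c : 'I_7 -> 'M[R]_8) (P : spin_data A).
Variables (phi : sidx P -> M -> 'cV[R]_8) (phi0 : 'cV[R]_8).
Hypotheses (hM : oriented_manifold A) (hc : clifford_module c).
Hypotheses (hP : spin_structure g c P) (hphi : unit_spinor_field phi).
Hypothesis hphi0 : unit_spinor phi0.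
Notation V := ('rV[R]_7).

Lemma smooth_dot (U : set V) n (f h : V -> 'cV[R]_n) : open U ->
  smooth U f -> smooth U h -> smooth U (fun x => dot (f x) (h x) : R^o).
Proof.
by move=> oU sf sh; apply: (smooth_mxP oU _).1 => //; apply: smooth_mulmx => //; exact: smooth_trmx.
Qed.

Lemma smooth_normal_spinor (U : set V) omega eta (f : V -> 'cV[R]_8) : open U ->
  smooth U f -> smooth U (fun x => normal_spinor omega eta (f x)).
Proof.
move=> oU sf.
have sh : smooth U (fun x => f x - dot (f x) omega *: omega).
  apply: smoothB => //; apply: smooth_scale => //; last exact: smooth_cst.
  by apply: smooth_dot => //; exact: smooth_cst.
apply: smoothB => //; apply: smooth_scale => //.
- exact: smooth_dot.
- exact: smooth_cst.
- by apply: smooth_dot => //; exact: smooth_cst.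
Qed.

Lemma smooth_spin_z (U : set V) (f h : V -> 'cV[R]_8) : open U ->
  smooth U f -> smooth U h -> smooth U (fun x => spin_z c (f x) (h x)).
Proof.
move=> oU sf sh; apply/smooth_mxP => // i j.
have : smooth U (fun x => dot (c j *m f x) (h x) : R^o).
  by apply: smooth_dot => //; apply: smooth_mulmx => //; exact: smooth_cst.
by apply: smooth_eq => // x _; rewrite mxE.
Qed.

Lemma smooth_reflection (U : set V) (n : V -> R^o) (f : V -> 'rV[R]_7) : open U ->
  (forall x, U x -> n x != 0) ->
  smooth U n -> smooth U f -> smooth U (fun x => reflection (n x) (f x)).
Proof.
move=> oU n0 sn sf; apply: smoothB => //; first exact: smooth_cst.
apply: smooth_scale => //.
  by apply: smoothM => //; [exact: smooth_cst|exact: smoothV].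
by apply: smooth_mulmx => //; exact: smooth_trmx.
Qed.

(** A constant element u2 of Spin(7) carries phi0 to omega, and transport through
    the common normal chi carries omega to phi. The normal chi degenerates where
    phi = omega or phi = - omega, so omega is chosen orthogonal to phi at p0;
    with eta normal to both, chi equals eta at p0, and is nonzero nearby. *)
Lemma adapted_frame_exists (b : sidx P) (p0 : M) : sdom b p0 ->
  exists (W : set M) (u : M -> 'M[R]_8) (Q : M -> 'M[R]_7),
  [/\ open W, W p0, W `<=` sdom b,
      smooth_on A W u /\ smooth_on A W Q &
      adapted_frame g c phi phi0 W (fun a q => Q q *m sframe b a q) /\
      forall q, W q -> [/\ spin_group c (u q), covers c (u q) (Q q),
         Q q *m (Q q)^T = 1%:M & phi b q = u q *m phi0]].
Proof.
move=> bp0; have u0 := sp_unit hphi bp0.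
pose i0 : 'I_7 := ord0; pose i1 : 'I_7 := lift ord0 ord0.
pose omega := c i0 *m phi b p0; pose eta := c i1 *m phi b p0.
have dcc i j : dot (c i *m phi b p0) (c j *m phi b p0) = (j == i)%:R.
  rewrite -!cl_delta (dot_clcl hc) (unit_dot u0) mulr1 row_dot (bigD1 i) //= big1 => [|l li].
    by rewrite !mxE !eqxx /= mul1r addr0 eq_sym.
  by rewrite !mxE (negbTE li) andbF mul0r.
have uo : unit_spinor omega by rewrite /unit_spinor dotE dcc eqxx.
have oe : dot omega eta = 0 by rewrite dcc.
have ue : dot eta eta = 1 by rewrite dcc eqxx.
have [u2 [Q2 [gu2 cu2 oQ2 dQ2 u2E]]] := spin_transitive hc hphi0 uo.
pose chi q := normal_spinor omega eta (phi b q).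
pose n q : R^o := dot (chi q) (chi q).
have oS := ss_open hP b.
have loc_phi (a : chart A) : smooth (chart_set a (sdom b)) (phi b \o local_param a).
  by apply/(smooth_inP hM) => //; exact: (sp_smooth hphi).
have loc_chi (a : chart A) : smooth (chart_set a (sdom b)) (chi \o local_param a).
  apply: smooth_normal_spinor; first exact: chart_set_open.
  exact: loc_phi.
have sn : smooth_on A (sdom b) n.
  move=> a; apply/(smooth_inP hM) => //.
  by apply: smooth_dot; [exact: chart_set_open|exact: loc_chi|exact: loc_chi].
pose W := [set q | sdom b q /\ n q != 0].
have WS : W `<=` sdom b by move=> q [].
have oW : open W.
  rewrite openE => q [bq nq].
  have cn := smooth_on_continuous hM oS sn bq.
  have nn : nbhs q (n @^-1` [set r | r != 0]).
    by apply: cn; apply: open_nbhs_nbhs; split.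
  exact: filterI (open_nbhs_nbhs (conj oS bq)) nn.
have Wp0 : W p0.
  split=> //; rewrite /n /chi normal_spinor_orth ?ue ?oner_eq0 //.
  - by rewrite /omega -(cl_delta c i0) (dot_cl hc).
  - by rewrite dotC /eta -(cl_delta c i1) (dot_cl hc).
exists W, (fun q => transport_spin c omega (phi b q) (chi q) *m u2),
  (fun q => Q2 *m transport_rot c omega (phi b q) (chi q)).
have oU (a : chart A) : open (chart_set a W) by exact: chart_set_open.
have sub (a : chart A) : chart_set a W `<=` chart_set a (sdom b) by exact: chart_set_sub.
have sphiW (a : chart A) : smooth (chart_set a W) (phi b \o local_param a) by exact: smooth_sub (loc_phi a).
have schiW (a : chart A) : smooth (chart_set a W) (chi \o local_param a) by exact: smooth_sub (loc_chi a).
have snW (a : chart A) : smooth (chart_set a W) (n \o local_param a) by apply: smooth_dot.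
have n0W (a : chart A) x : chart_set a W x -> n (local_param a x) != 0 by move=> [_ []].
have sy (a : chart A) : smooth (chart_set a W)
    (fun x => spin_y c (phi b (local_param a x)) (chi (local_param a x))).
  by apply: smoothN => //; exact: smooth_spin_z.
have sz (a : chart A) : smooth (chart_set a W) (fun x => spin_z c omega (chi (local_param a x))).
  by apply: smooth_spin_z => //; exact: smooth_cst.
have su : smooth_on A W (fun q => transport_spin c omega (phi b q) (chi q) *m u2).
  move=> a; apply/(smooth_inP hM) => //.
  apply: smooth_mulmx => //; last exact: smooth_cst.
  apply: smooth_scale => //; first exact: (smoothV (oU a) (n0W a) (snW a)).
  apply: smooth_mulmx => //.
    exact: (smooth_linmx (oU a) (cl c) (sy a)).
  exact: (smooth_linmx (oU a) (cl c) (sz a)).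
have sQ : smooth_on A W (fun q => Q2 *m transport_rot c omega (phi b q) (chi q)).
  move=> a; apply/(smooth_inP hM) => //.
  apply: smooth_mulmx => //; first exact: smooth_cst.
  apply: smooth_mulmx => //.
    exact: (smooth_reflection (oU a) (n0W a) (snW a) (sz a)).
  exact: (smooth_reflection (oU a) (n0W a) (snW a) (sy a)).
have main q : W q -> [/\ spin_group c (transport_spin c omega (phi b q) (chi q) *m u2),
   covers c (transport_spin c omega (phi b q) (chi q) *m u2)
     (Q2 *m transport_rot c omega (phi b q) (chi q)),
   (Q2 *m transport_rot c omega (phi b q) (chi q))
     *m (Q2 *m transport_rot c omega (phi b q) (chi q))^T = 1%:M
   & phi b q = transport_spin c omega (phi b q) (chi q) *m u2 *m phi0].
  move=> [bq nq]; have uq := sp_unit hphi bq.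
  have [h1 h2] := normal_spinorP (phi b q) uo oe.
  split.
  - exact: transport_spin_group.
  - by apply: covers_mul => //; exact: transport_covers.
  - rewrite trmx_mul mulmxA -(mulmxA Q2) transport_rot_orth // mulmx1.
    exact: oQ2.
  - by rewrite -mulmxA u2E transport_spinE.
split=> //; split=> //; split.
  have sf := ss_frame hP b.
  split.
  - move=> a; apply/(smooth_inP hM) => //; apply: smooth_mulmx => //.
      by have /(smooth_inP hM _ _ oW) := sQ a.
    have /(smooth_inP hM _ _ oS) := sf_smooth sf (a := a).
    exact: smooth_sub.
  - by move=> a a' q Wq aq aq'; rewrite (sf_tensor sf (WS _ Wq) aq aq') mulmxA.
  - move=> a q Wq aq; have [_ _ oQ _] := main q Wq.
    move: oQ; move: (Q2 *m transport_rot _ _ _ _) => Q oQ.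
    transitivity (Q *m (sframe b a q *m g a q *m (sframe b a q)^T) *m Q^T).
      by rewrite trmx_mul !mulmxA.
    by rewrite (sf_orthonormal sf (WS _ Wq) aq) mulmx1.
  - move=> a q Wq aq; have [bq nq] := Wq; have uq := sp_unit hphi bq.
    have [h1 h2] := normal_spinorP (phi b q) uo oe.
    rewrite (det_mulmx (Q2 *m _)) (det_mulmx Q2) dQ2 mul1r.
    rewrite (transport_rot_det hc uo uq h1 h2 nq) mul1r.
    exact: (sf_positive sf bq aq).
move=> b' a q Wq b'q aq; have [gu cu _ pE] := main q Wq.
have bq := WS _ Wq.
(* T changes the frame of another trivialization into that of b. *)
pose T := sframe b a q *m g a q *m (sframe b' a q)^T.
have fE : sframe b a q = T *m sframe b' a q.
  have o' := sf_orthonormal (ss_frame hP b') b'q aq.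
  have := mulmx1C (etrans (mulmxA _ _ _) o').
  by rewrite /T -mulmxA mulmxA => h; rewrite -!mulmxA [g a q *m _]mulmxA h mulmx1.
exists (strans b' b q *m (transport_spin c omega (phi b q) (chi q) *m u2)),
  (Q2 *m transport_rot c omega (phi b q) (chi q) *m T).
split.
- have := ss_spin hP b'q bq; elim=> [|x y v hx hy _ IH]; first by rewrite mul1mx.
  by rewrite -mulmxA; exact: spin_mul.
- by apply: covers_mul => //; exact: (ss_lift hP b'q bq aq fE).
- by rewrite {1}fE mulmxA.
- by rewrite (sp_trans hphi b'q bq) {1}pE !mulmxA.
Qed.

(** * Intrinsic torsion and harmonicity *)

Section Torsion.
Variables (nablaG : coeffs A) (S : mfield A).
Hypotheses (hg : riemannian_metric g) (hG : g2_connection g c phi phi0 nablaG).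
Hypotheses (hS : endomorphism_field S) (hphiS : spinor_endomorphism g c phi S).

Implicit Types (a : chart A) (b : sidx P) (v x : V) (W : set M).

Notation gh a := (g a \o local_param a).
Notation Fh b a := (sframe b a \o local_param a).
Notation ph b a := (phi b \o local_param a).
Notation Sh a := (S a \o local_param a).
Notation U b a := (chart_set a (sdom b)).

Lemma levi_civita_param a W v x : chart_set a W x ->
  along (levi_civita g) a (local_param a x) v = lcmx (gh a) v x.
Proof.
move=> Ux.
pose chr (d : 'I_7 -> 'M[R]_7) (h : 'M[R]_7) i : 'M[R]_7 := \matrix_(j, k)
  (2^-1 * \sum_l (d i j l + d j i l - d l i j) * invmx h l k).
have E : (fun i => mder a (basis_vec R i) (g a) (local_param a x))
    = (fun i => 'D_(basis_vec R i) (gh a) x).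
  by apply/funext => i; exact: (mder_param hM _ _ Ux).
transitivity (\sum_i v 0 i *:
    chr (fun i => mder a (basis_vec R i) (g a) (local_param a x)) (gh a x) i).
  by [].
by rewrite E.
Qed.

Lemma conn_form_param a b v x : U b a x ->
  conn_form g (levi_civita g) (sframe b) a (local_param a x) v
  = lcform (gh a) (Fh b a) v x.
Proof.
by move=> Ux; rewrite /conn_form (mder_param hM _ _ Ux) (levi_civita_param v Ux) lcform.unlock.
Qed.

Lemma local_smooth_metric a W : open W -> smooth (chart_set a W) (gh a).
Proof.
move=> oW; apply: smooth_sub (@chart_set_sub _ _ A a W [set: M] (@subsetT _ _)) _.
by apply/(smooth_inP hM); [exact: openT|exact: (rm_smooth hg)].
Qed.

Lemma local_smooth_endo a W : open W -> smooth (chart_set a W) (Sh a).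
Proof.
move=> oW; apply: smooth_sub (@chart_set_sub _ _ A a W [set: M] (@subsetT _ _)) _.
by apply/(smooth_inP hM); [exact: openT|exact: (ef_smooth hS)].
Qed.

Lemma local_smooth_frame a b : smooth (U b a) (Fh b a).
Proof. by apply/(smooth_inP hM); [exact: (ss_open hP)|exact: (sf_smooth (ss_frame hP b))]. Qed.

Lemma local_smooth_spinor a b : smooth (U b a) (ph b a).
Proof. by apply/(smooth_inP hM); [exact: (ss_open hP)|exact: (sp_smooth hphi)]. Qed.

Lemma local_open a b : open (U b a).
Proof. by apply: (chart_set_open hM); exact: (ss_open hP). Qed.

Lemma local_metric_sym a b x : U b a x -> (gh a x)^T = gh a x.
Proof. by move=> /(chart_set_inv hM) [ax _ _]; exact: (rm_sym hg). Qed.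

Lemma local_orthonormal a b x : U b a x ->
  Fh b a x *m gh a x *m (Fh b a x)^T = 1%:M.
Proof.
by move=> /(chart_set_inv hM) [ax bx _]; exact: (sf_orthonormal (ss_frame hP b) bx ax).
Qed.

Lemma local_unit a b x : U b a x -> unit_spinor (ph b a x).
Proof. by move=> /(chart_set_inv hM) [_ bx _]; exact: (sp_unit hphi). Qed.

Lemma local_spinor_eq a b v x : U b a x ->
  'D_v (ph b a) x + spin_lift c (lcform (gh a) (Fh b a) v x) *m ph b a x
  = cl c (v *m Sh a x *m coframe (gh a) (Fh b a) x) *m ph b a x.
Proof.
move=> Ux; have [ax bx cx] := chart_set_inv hM Ux.
have := hphiS v bx ax; rewrite /nabla_spinor (mder_param hM _ _ Ux) conn_form_param //.
by move=> ->; rewrite /clifford_mul coframe.unlock !mulmxA.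
Qed.

Lemma along_intrinsic a p v :
  along (intrinsic_torsion g nablaG) a p v
  = along nablaG a p v - along (levi_civita g) a p v.
Proof. by rewrite /along -sumrB; apply: eq_bigr => i _; rewrite scalerBr. Qed.

(** The derivative of u X = (X Q) u, multiplied by u^T, shows that u^T u' acts on
    vectors as Q' Q^T does; [skew_eq_lift] then identifies it. *)
Lemma spin_log_derive (u : V -> 'M[R]_8) (Q : V -> 'M[R]_7) x v du dQ :
  (\forall y \near x, (u y)^T *m u y = 1%:M) ->
  (\forall y \near x, Q y *m (Q y)^T = 1%:M) ->
  (\forall y \near x, covers c (u y) (Q y)) ->
  is_derive x v u du -> is_derive x v Q dQ ->
  so7 (dQ *m (Q x)^T) /\ (u x)^T *m du = spin_lift c (dQ *m (Q x)^T).
Proof.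
move=> nu nQ nc hu hQ.
have ux := nbhs_singleton nu; have Qx := nbhs_singleton nQ; have cx := nbhs_singleton nc.
have uxT : u x *m (u x)^T = 1%:M by apply: mulmx1C.
have QxT : (Q x)^T *m Q x = 1%:M by apply: mulmx1C.
have sB : so7 (dQ *m (Q x)^T).
  have := is_derive_mulmx hQ (is_derive_trmx hQ).
  move=> /(near_eq_is_derive nQ) /deriveP; rewrite derive_cst => /esym.
  rewrite /so7 trmx_mul trmxK addrC => /eqP; rewrite addr_eq0 => /eqP.
  by [].
split=> //; apply: skew_eq_lift => //.
  have := is_derive_mulmx (is_derive_trmx hu) hu.
  move=> /(near_eq_is_derive nu) /deriveP; rewrite derive_cst => /esym.
  rewrite trmx_mul trmxK => /eqP; rewrite addr_eq0 => /eqP.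
  by [].
move=> t; have ct : is_derive x v (fun=> cl c t) (0 : 'M[R]_8) by exact: is_derive_cst.
have ct' : is_derive x v (fun=> t) (0 : V) by exact: is_derive_cst.
have h1 := is_derive_mulmx hu ct.
have h2 := is_derive_mulmx (is_derive_linmx (cl c) (is_derive_mulmx ct' hQ)) hu.
have nct : \forall y \near x, cl c (t *m Q y) *m u y = u y *m cl c t.
  by apply: filterS nc => y cy; rewrite cy.
have := etrans (esym (deriveP h1)) (deriveP (near_eq_is_derive nct h2)).
rewrite mulmx0 addr0 mul0mx add0r => E.
have e1 : (u x)^T *m cl c (t *m Q x) = cl c t *m (u x)^T.
  have := congr1 (fun B => (u x)^T *m B *m (u x)^T) (cx t).
  by rewrite !mulmxA ux mul1mx -!mulmxA uxT mulmx1.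
have e2 : (u x)^T *m cl c (t *m dQ) *m u x = cl c (t *m (dQ *m (Q x)^T)).
  have := cx (t *m (dQ *m (Q x)^T)); rewrite -!mulmxA QxT mulmx1 => <-.
  by rewrite mulmxA ux mul1mx.
have := congr1 (mulmx (u x)^T) E; rewrite mulmxDr !mulmxA e1 e2 => ->.
by rewrite addrK mulmxA.
Qed.

(** In the adapted frame Q F, with phi = u phi0, the connection forms of nabla^G
    and nabla^g differ by the torsion, conjugated by Q. The former annihilates
    phi0; conjugating back by u and adding the spinor equation for nabla^g phi, the
    lift of the torsion Xi sends phi to - S(v) . phi. As Xi is orthogonal to the
    stabilizer of phi, [g2_perp_cross] determines it. *)
Lemma torsion_formula a b x v : U b a x ->
  along (intrinsic_torsion g nablaG) a (local_param a x) v
  = torsion_field c (gh a) (Fh b a) (Sh a) (ph b a) v x.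
Proof.
move=> Ux; have [ap bp cx] := chart_set_inv hM Ux.
set p := local_param a x in ap bp *.
have [W [u [Q [oW Wp WS [su sQ] [aF main]]]]] := adapted_frame_exists bp.
have UWx : chart_set a W x by split; [exact: Ux.1|].
have oUW := chart_set_open (a := a) hM oW.
have [hg2 hperp] := hG oW aF v Wp ap.
have [gu cu oQ pE] := main p Wp.
have uu := spin_group_orth hc gu.
have Fon := local_orthonormal Ux.
have su' : smooth (chart_set a W) (u \o local_param a) by apply/(smooth_inP hM) => //; exact: su.
have sQ' : smooth (chart_set a W) (Q \o local_param a) by apply/(smooth_inP hM) => //; exact: sQ.
have du := diff_is_derive v (smooth_diff su' UWx).
have dQ := diff_is_derive v (smooth_diff sQ' UWx).
have nUW := open_nbhs_nbhs (conj oUW UWx).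
have [sB lB] := spin_log_derive (filterS (fun y (Uy : chart_set a W y) =>
    spin_group_orth hc (let: And4 h _ _ _ := main _ Uy.2 in h)) nUW)
  (filterS (fun y (Uy : chart_set a W y) => let: And4 _ _ h _ := main _ Uy.2 in h) nUW)
  (filterS (fun y (Uy : chart_set a W y) => let: And4 _ h _ _ := main _ Uy.2 in h) nUW)
  du dQ.
rewrite /= -/p in lB sB; set B := _ *m (Q p)^T in lB sB.
pose Fm := Fh b a x; pose O := lcform (gh a) (Fh b a) v x.
have hO : so7 O := lcform_skew (@local_open a b) (@local_smooth_metric a (sdom b) (ss_open hP b))
  (@local_smooth_frame a b) (@local_metric_sym a b) (@local_orthonormal a b) v Ux.
pose xi := along (intrinsic_torsion g nablaG) a p v.
pose Xi := Fm *m xi *m g a p *m Fm^T.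
(* Gauge transformation of the connection form by Q. *)
have om' : conn_form g (levi_civita g) (fun a q => Q q *m sframe b a q) a p v
    = B + Q p *m O *m (Q p)^T.
  have dF := diff_is_derive v (smooth_diff (@local_smooth_frame a b) Ux).
  have dQF := deriveP (is_derive_mulmx dQ dF).
  rewrite /conn_form (mder_param hM _ _ Ux) (levi_civita_param v Ux) /=.
  rewrite -[_ \o _]/(fun y => (Q \o local_param a) y *m (Fh b a) y) dQF /O lcform.unlock /B /=.
  rewrite -/p trmx_mul.
  transitivity ('D_v (Q \o local_param a) x *m (Fm *m g a p *m Fm^T) *m (Q p)^T
    + Q p *m (('D_v (Fh b a) x + Fm *m lcmx (gh a) v x) *m g a p *m Fm^T) *m (Q p)^T).
    by rewrite /Fm /= -/p; mxexpand; mxabel.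
  by rewrite Fon mulmx1.
have dconn : conn_form g (levi_civita g) (fun a q => Q q *m sframe b a q) a p v
    - conn_form g nablaG (fun a q => Q q *m sframe b a q) a p v
    = - (Q p *m Xi *m (Q p)^T).
  rewrite /conn_form /Xi /xi along_intrinsic trmx_mul /Fm /= -/p.
  by mxexpand; mxabel.
have QTQ : (Q p)^T *m Q p = 1%:M by apply: mulmx1C.
have uuT : u p *m (u p)^T = 1%:M by apply: mulmx1C.
have Xi_perp : g2_perp c (phi b p) Xi.
  have [sk tr] := hperp; rewrite dconn in sk tr.
  have XiE : Xi = (Q p)^T *m (Q p *m Xi *m (Q p)^T) *m Q p.
    by rewrite !mulmxA QTQ mul1mx -mulmxA QTQ mulmx1.
  split.
    move: sk XiE; rewrite /so7 raddfN /= => /oppr_inj.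
    move: (Q p *m Xi *m (Q p)^T) => Y sk ->.
    by rewrite !trmx_mul sk trmxK mulNmx mulmxN mulmxA.
  move=> C [sC lC].
  have sC' : so7 (Q p *m C *m (Q p)^T).
    by rewrite /so7 !trmx_mul trmxK sC mulNmx mulmxN mulmxA.
  have gC : g2 c phi0 (Q p *m C *m (Q p)^T).
    split=> //; have := covers_lift (Q p *m C *m (Q p)^T) cu.
    rewrite !mulmxA QTQ mul1mx -(mulmxA C) QTQ mulmx1 => e.
    have := congr1 (mulmx (u p)^T) (congr1 (mulmx^~ phi0) e).
    rewrite -[spin_lift c C *m u p *m phi0]mulmxA -pE lC mulmx0.
    by rewrite !mulmxA uu mul1mx.
  have := tr _ gC; rewrite raddfN mulNmx raddfN /= => /eqP; rewrite oppr_eq0 => /eqP.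
  rewrite !trmx_mul trmxK => <-.
  rewrite !mulmxA [in RHS]mxtrace_mulC !mulmxA QTQ mul1mx.
  by rewrite -(mulmxA _ (Q p)^T) QTQ mulmx1.
have lXi : spin_lift c Xi *m phi b p
    = - (cl c (v *m S a p *m coframe (gh a) (Fh b a) x) *m phi b p).
  have [sk] := hg2.
  have -> : conn_form g nablaG (fun a q => Q q *m sframe b a q) a p v
      = B + Q p *m (O + Xi) *m (Q p)^T.
    move: dconn; rewrite om' => /eqP; rewrite subr_eq => /eqP e.
    by rewrite mulmxDr mulmxDl addrA e addrAC addNr add0r.
  rewrite linearD /= -lB => /(congr1 (mulmx (u p))).
  rewrite mulmx0 mulmxA mulmxDr [u p *m (_ *m _)]mulmxA uuT mul1mx (covers_lift _ cu).
  have -> : (Q p)^T *m (Q p *m (O + Xi) *m (Q p)^T) *m Q p = O + Xi.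
    by rewrite !mulmxA QTQ mul1mx -mulmxA QTQ mulmx1.
  rewrite mulmxDl -[spin_lift c _ *m u p *m phi0]mulmxA -pE linearD mulmxDl /=.
  have -> : 'D_v (u \o local_param a) x *m phi0 = 'D_v (ph b a) x.
    have c0 : is_derive x v (fun=> phi0) (0 : 'cV[R]_8) by exact: is_derive_cst.
    have := deriveP (is_derive_mulmx du c0); rewrite mulmx0 addr0 => <-.
    apply: near_eq_derive; apply: filterS nUW => y [_ Wy].
    by have [_ _ _ /= ->] := main _ Wy.
  rewrite addrA => /eqP; rewrite addr_eq0 => /eqP e.
  apply/eqP; rewrite -eqr_oppLR; apply/eqP; rewrite -e.
  exact: local_spinor_eq.
have XiE := g2_perp_cross hc (local_unit Ux) Xi_perp lXi.
have IF : coframe (gh a) (Fh b a) x *m Fh b a x = 1%:M.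
  exact: (FinvF (@local_orthonormal a b) Ux).
have XiF : Xi = Fm *m xi *m coframe (gh a) (Fh b a) x.
  by rewrite coframe.unlock /Xi !mulmxA.
rewrite /torsion_field; transitivity (coframe (gh a) (Fh b a) x *m Xi *m Fm).
  by rewrite XiF /Fm !mulmxA IF mul1mx -mulmxA IF mulmx1.
by rewrite XiE linearZ /= -scalemxAr -scalemxAl.
Qed.

Notation nab a := (nabla_endo (gh a) (Sh a)).

Lemma torsion_divergence a b x (E : 'M[R]_7) : U b a x ->
  Fh b a x *m (\sum_i cov_der g (intrinsic_torsion g nablaG) a (local_param a x)
      (row i E) (row i E)) *m coframe (gh a) (Fh b a) x
  = (2 / 3) *: crossmx c (ph b a x)
      ((\sum_i row i E *m nab a (row i E) x) *m coframe (gh a) (Fh b a) x).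
Proof.
move=> Ux; rewrite !mulmx_suml mulmx_sumr mulmx_suml linear_sum scaler_sumr.
apply: eq_bigr => i _; move: (row i E) => v /=.
have oU := @local_open a b.
rewrite /cov_der (mder_param hM _ _ Ux) (levi_civita_param _ Ux) !(torsion_formula _ Ux).
rewrite -(torsion_cov_der hc oU (@local_smooth_metric a (sdom b) (ss_open hP b))
  (@local_smooth_frame a b) (@local_smooth_endo a (sdom b) (ss_open hP b)) (@local_smooth_spinor a b)
  (@local_metric_sym a b) (@local_orthonormal a b) (@local_spinor_eq a b) v Ux).
suff -> : 'D_v ((along (intrinsic_torsion g nablaG) a)^~ v \o local_param a) x
    = 'D_v (torsion_field c (gh a) (Fh b a) (Sh a) (ph b a) v) x by [].
apply: near_eq_derive; apply: filterS (open_nbhs_nbhs (conj oU Ux)) => y Uy.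
exact: torsion_formula.
Qed.

(** Contraction with the 3-form is injective. *)
Lemma harmonic_at a b x (E : 'M[R]_7) : U b a x ->
  \sum_i cov_der g (intrinsic_torsion g nablaG) a (local_param a x) (row i E) (row i E) = 0
  <-> \sum_i row i E *m nab a (row i E) x = 0.
Proof.
move=> Ux; have h := torsion_divergence E Ux.
have IF := FinvF (@local_orthonormal a b) Ux.
split=> e.
  move: h; rewrite e mulmx0 mul0mx => /esym/eqP.
  rewrite scaler_eq0 mulf_eq0 invr_eq0 !pnatr_eq0 /= => /eqP.
  move=> /(cross_inj hc (local_unit Ux)) /(congr1 (mulmx^~ (Fh b a x))).
  by rewrite -mulmxA IF mulmx1 mul0mx.
move: h; rewrite e mul0mx linear0 scaler0 => h.
have := congr1 (fun B => coframe (gh a) (Fh b a) x *m B *m Fh b a x) h.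
by rewrite mulmx0 mul0mx !mulmxA IF mul1mx -mulmxA IF mulmx1.
Qed.

Lemma nabla_endo_sum a b x v : U b a x ->
  nab a v x = \sum_k v 0 k *: nab a (basis_vec R k) x.
Proof.
move=> Ux; have sS := smooth_diff (@local_smooth_endo a (sdom b) (ss_open hP b)) Ux.
have Gb k : \sum_i basis_vec R k 0 i *: christoffel (gh a) x i = christoffel (gh a) x k.
  rewrite (bigD1 k) //= big1 => [|l lk]; last by rewrite mxE (negbTE lk) andbF scale0r.
  by rewrite mxE !eqxx scale1r addr0.
rewrite /nabla_endo (derive_dir_sum v sS) /lcmx mulmx_sumr mulmx_suml -big_split -sumrB.
apply: eq_bigr => k _ /=.
by rewrite Gb -scalemxAr -scalemxAl -scalerDr -scalerBr.
Qed.

(** The divergence depends on E through E^T E only, which is the inverse metric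
    for every orthonormal frame. *)
Lemma divergence_frame a b x (E : 'M[R]_7) : U b a x ->
  E *m gh a x *m E^T = 1%:M ->
  \sum_i row i E *m nab a (row i E) x
  = \sum_i row i (Fh b a x) *m nab a (row i (Fh b a x)) x.
Proof.
move=> Ux oE.
have T (B : 'M[R]_7) : \sum_i row i B *m nab a (row i B) x
    = \sum_k row k (B^T *m B) *m nab a (basis_vec R k) x.
  transitivity (\sum_i \sum_k (B i k *: row i B) *m nab a (basis_vec R k) x).
    apply: eq_bigr => i _; rewrite (nabla_endo_sum _ Ux) mulmx_sumr.
    by apply: eq_bigr => k _; rewrite mxE -scalemxAr -scalemxAl.
  rewrite exchange_big; apply: eq_bigr => k _ /=; rewrite -mulmx_suml; congr (_ *m _).
  apply/matrixP => o l; rewrite summxE !mxE; apply: eq_bigr => i _.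
  by rewrite !mxE.
have inv (B : 'M[R]_7) : B *m gh a x *m B^T = 1%:M -> gh a x *m (B^T *m B) = 1%:M.
  by rewrite -mulmxA => /mulmx1C; rewrite mulmxA.
have e1 := inv _ oE; have e2 := mulmx1C (inv _ (local_orthonormal Ux)).
rewrite !T; suff -> : E^T *m E = (Fh b a x)^T *m Fh b a x by [].
by rewrite -[LHS]mul1mx -e2 -mulmxA e1 mulmx1.
Qed.

Lemma harmonic_of_traceless : symmetric_endo g S -> traceless_endo S ->
  harmonic_g2 g nablaG.
Proof.
move=> hsym htr a p E ap oE; have [b bp] := ss_cover hP p.
have Ux : U b a (local_coord a p) by exact: (chart_setP hM).
have pE := om_paramK hM ap.
have := harmonic_at E Ux; rewrite pE => -[_]; apply.
rewrite (divergence_frame Ux); last by rewrite /= pE.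
apply: (traceless_divergence hc (@local_open a b) (@local_smooth_metric a (sdom b) (ss_open hP b))
  (@local_smooth_frame a b) (@local_smooth_endo a (sdom b) (ss_open hP b)) (@local_smooth_spinor a b)
  (@local_metric_sym a b) (@local_orthonormal a b) (@local_unit a b) (@local_spinor_eq a b)
  _ _ Ux) => y /(chart_set_inv hM) [ay _ _] /=.
  apply/matrixP => i j.
  have := hsym a _ (delta_mx 0 i) (delta_mx 0 j) ay.
  rewrite trmx_mul mulmxA -[_ *m S a _ *m g a _]mulmxA.
  rewrite -[delta_mx 0 i *m g a _ *m _]mulmxA !trmx_delta -!rowE.
  rewrite -!colE => /matrixP /(_ 0 0); by rewrite !mxE.
exact: htr.
Qed.

Section Scalar.
Variable lam : M -> R.
Hypotheses (sl : smooth_on A [set: M] (lam : M -> R^o)) (hl : scalar_endo S lam).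
Notation lh a := ((lam : M -> R^o) \o local_param a).

Lemma local_smooth_scalar a b : smooth (U b a) (lh a).
Proof.
apply: smooth_sub (@chart_set_sub _ _ A a _ [set: M] (@subsetT _ _)) _.
by apply/(smooth_inP hM); [exact: openT|exact: sl].
Qed.

Lemma nabla_scalar a b x v : U b a x -> nab a v x = ('D_v (lh a) x)%:M.
Proof.
move=> Ux; have dl := diff_is_derive v (smooth_diff (@local_smooth_scalar a b) Ux).
have SE y : U b a y -> Sh a y = (lh a y)%:M.
  by move=> /(chart_set_inv hM) [ay _ _] /=; exact: hl.
rewrite /nabla_endo (SE x Ux) mul_scalar_mx mul_mx_scalar addrK.
have nS : \forall y \near x, ((lh a y)%:M : 'M[R]_7) = Sh a y.
  by apply: filterS (open_nbhs_nbhs (conj (@local_open a b) Ux)) => y /SE ->.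
apply: deriveP; apply: (near_eq_is_derive nS); apply/is_derive_mxP => i j.
have -> : (fun y => (lh a y)%:M i j : R^o) = (i == j)%:R \*: lh a.
  apply/funext => y; rewrite mxE -[RHS]/((i == j)%:R * lam (local_param a y)).
  by rewrite mulr_natl.
have -> : ('D_v (lh a) x)%:M i j = (i == j)%:R *: 'D_v (lh a) x.
  by rewrite mxE /GRing.scale /= mulr_natl.
exact: is_deriveZ.
Qed.

Lemma scalar_divergence a b x (E : 'M[R]_7) : U b a x ->
  \sum_i row i E *m nab a (row i E) x = (\row_i 'D_(row i E) (lh a) x) *m E.
Proof.
move=> Ux; rewrite mulmx_sum_row; apply: eq_bigr => i _.
by rewrite (nabla_scalar _ Ux) mul_mx_scalar mxE.
Qed.

(** The divergence of lam Id is the gradient of lam. *)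
Lemma harmonic_scalar : harmonic_g2 g nablaG <-> is_constant lam.
Proof.
split=> [hh|[k hk] a p E ap oE].
  apply: (derive0_is_constant hM sl) => a p v ap; have [b bp] := ss_cover hP p.
  have Ux : U b a (local_coord a p) by exact: (chart_setP hM).
  have pE := om_paramK hM ap; set x := local_coord a p in Ux pE *.
  have on := local_orthonormal Ux; have FI := FFinv (@local_orthonormal a b) Ux.
  have IF := FinvF (@local_orthonormal a b) Ux.
  have h0 : \sum_i cov_der g (intrinsic_torsion g nablaG) a (local_param a x)
      (row i (Fh b a x)) (row i (Fh b a x)) = 0.
    by rewrite pE; apply: hh => //; move: on; rewrite /= pE.
  move/(harmonic_at _ Ux): h0; rewrite (scalar_divergence _ Ux).
  move=> /(congr1 (mulmx^~ (coframe (gh a) (Fh b a) x))).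
  rewrite mul0mx -mulmxA FI mulmx1 => d0.
  have {}d0 i : 'D_(row i (Fh b a x)) (lh a) x = 0.
    by have := congr1 (fun w : V => w 0 i) d0; rewrite !mxE.
  have sd := smooth_diff (@local_smooth_scalar a b) Ux.
  rewrite -[mder a v _ p]/('D_v (lh a) x) deriveE //.
  have -> : v = \sum_i (v *m coframe (gh a) (Fh b a) x) 0 i *: row i (Fh b a x).
    by rewrite -mulmx_sum_row -mulmxA IF mulmx1.
  rewrite raddf_sum big1 // => i _ /=; rewrite linearZ /=.
  by rewrite -deriveE // d0 scaler0.
have [b bp] := ss_cover hP p.
have Ux : U b a (local_coord a p) by exact: (chart_setP hM).
have pE := om_paramK hM ap.
have := harmonic_at E Ux; rewrite pE => -[_]; apply.
rewrite (scalar_divergence _ Ux).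
have -> : lh a = cst k by apply/funext => y; exact: hk.
have -> : \row_i 'D_(row i E) (cst k : V -> R^o) (local_coord a p) = 0.
  by apply/matrixP => o i; rewrite !mxE derive_cst.
by rewrite mul0mx.
Qed.

Lemma constant_nearly_parallel : is_constant lam <-> nearly_parallel S.
Proof.
split=> -[k hk]; exists k.
  by move=> a p ap; rewrite (hl ap) hk.
move=> p; have [a ap] := om_cover hM p.
by have := hk a p ap; rewrite (hl ap) => /matrixP /(_ 0 0); rewrite !mxE.
Qed.

End Scalar.
End Torsion.
End AdaptedFrames.

Theorem corollary4p3 (R : realType) (M : topologicalType) (A : atlas R M)
    (g : mfield A) (c : 'I_7 -> 'M[R]_8) (P : spin_data A)
    (phi : sidx P -> M -> 'cV[R]_8) (phi0 : 'cV[R]_8)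
    (nablaG : coeffs A) (S : mfield A)
    (hM : oriented_manifold A)
    (hg : riemannian_metric g)
    (hc : clifford_module c)
    (hP : spin_structure g c P)
    (hphi : unit_spinor_field phi)
    (hphi0 : unit_spinor phi0)
    (hG : g2_connection g c phi phi0 nablaG)
    (hS : endomorphism_field S)
    (hphiS : spinor_endomorphism g c phi S) :
  (forall lam : M -> R, smooth_on A [set: M] lam -> scalar_endo S lam ->
     (harmonic_g2 g nablaG <-> is_constant lam) /\
     (is_constant lam <-> nearly_parallel S)) /\
  (symmetric_endo g S -> traceless_endo S -> harmonic_g2 g nablaG).
Proof.
split=> [lam sl hl|hsym htr].
  split; last exact: (constant_nearly_parallel hM hl).
  exact: (harmonic_scalar hM hc hP hphi hphi0 hg hG hS hphiS sl hl).
exact: (harmonic_of_traceless hM hc hP hphi hphi0 hg hG hS hphiS hsym htr).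
Qed.
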